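(* There is an absolute constant $C>0$ such that the following holds. Let $L > 0$, and let $E \subset \mathbb{R}^2$ be a compact subset of the open unit ball $B(0,1)$ with $\mathcal{S}^1(E) \le L$. Let $N \ge 1$ be an integer, and suppose there are scales $$0 < r_{N,-} \le r_{N,+} \le r_{N-1,-} \le r_{N-1,+} \le \dots \le r_{1,-} \le r_{1,+} \le 1$$ such that: (1) for all $1 \le n \le N$, $\mathcal{S}^1_{r_{n,-},r_{n,+}}(E) \le L$; (2) for all $1 \le n < N$, $r_{n+1,+} \le \frac12 r_{n,-}$; (3) for all $1 \le n < N$, $R_E\big(r_{n+1,+}, r_{n,-}, 1/r_{n,-}\big) \le N^{-1/100}$. Then $\mathrm{Fav}(E) \le C N^{-1/100} L$.
   Context: For $E \subset \mathbb{R}^2$ and $0 \le r_- < r_+$ (or $r_-\le r_+$), the restricted spherical content is $\mathcal{S}^1_{r_-,r_+}(E) = \inf \sum_{B \in \mathcal{B}} \mathrm{diam}(B)$, the infimum over all at most countable collections $\mathcal{B}$ of open balls of radii in $[r_-,r_+]$ covering $E$. The one-dimensional spherical measure is $\mathcal{S}^1(E) = \lim_{r_+\to 0}\mathcal{S}^1_{0,r_+}(E)$. Let $\sigma$ be arclength measure on $S^1$ normalised to total mass $1$, and $m$ Lebesgue measure on $\mathbb{R}$. For $(c,\omega) \in \mathbb{R}\times S^1$ let $l_{c,\omega} = \{x \in \mathbb{R}^2 : x\cdot\omega = c\}$. The Favard length of $E \subset \mathbb{R}^2$ is $\mathrm{Fav}(E) = (m\times\sigma)(\{(c,\omega) \in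 \mathbb{R}\times S^1 : l_{c,\omega}\cap E \ne \emptyset\})$. For $\varepsilon, r, M > 0$ the rectifiability constant is $$R_E(\varepsilon,r,M) = \sup \frac{m(\{x \in J : x\omega_1 + (F(x)+y)\omega_2 \in E \text{ for some } -\varepsilon \le y \le \varepsilon\})}{m(J)},$$ the supremum over all orthonormal $\omega_1,\omega_2 \in S^1$, all $F:\mathbb{R}\to\mathbb{R}$ with Lipschitz constant at most $M$, and all intervals $J \subset \mathbb{R}$ of length at least $r$. *)

(* Defs.v *)
From HB Require Import structures.
From mathcomp Require Import all_boot all_order all_algebra.
From mathcomp Require Import all_classical all_reals all_analysis.
Set Implicit Arguments. Unset Strict Implicit. Unset Printing Implicit Defensive.
Import Order.TTheory GRing.Theory Num.Theory.
Import numFieldNormedType.Exports.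
Local Open Scope classical_set_scope.
Local Open Scope ring_scope.

Section Defs.
Variable R : realType.

(* Euclidean open ball in R^2 = R * R (the library norm on R*R is the max norm). *)
Definition eball (c : R * R) (r : R) : set (R * R) :=
  [set y | (y.1 - c.1) ^+ 2 + (y.2 - c.2) ^+ 2 < r ^+ 2].

(* Restricted spherical content S^1_{r-,r+}(E): infimum of sum of diameters (= 2 * radius)
   over at most countable families (indexed by a subset J of nat) of open balls with
   radii in [r-, r+] covering E. *)
Definition sph_content (rm rp : R) (E : set (R * R)) : \bar R :=
  ereal_inf [set s : \bar R | exists (J : set nat) (c : nat -> R * R) (r : nat -> R),
    [/\ (forall n, J n -> rm <= r n <= rp),
        E `<=` \bigcup_(n in J) eball (c n) (r n) &
        s = (\sum_(n <oo | n \in J) ((2 * r n)%:E))%E]].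

Definition sph_measure (E : set (R * R)) : \bar R :=
  lim ((fun rp : R => sph_content 0 rp E) @ at_right 0).

(* Favard length: (m x sigma) of the set of lines meeting E, with S^1 parametrised by
   theta in [0, 2 pi) via omega = (cos theta, sin theta), sigma = dtheta / (2 pi). *)
Definition favard (E : set (R * R)) : \bar R :=
  let lines := [set p : R * R | 0 <= p.2 < 2 * pi /\
        exists2 x, E x & x.1 * cos p.2 + x.2 * sin p.2 = p.1] in
  (((2 * pi)^-1)%:E *
   ((@lebesgue_measure R) \x (@lebesgue_measure R)) lines)%E.

Definition good_set (E : set (R * R)) (eps : R) (w1 w2 : R * R) (F : R -> R) (a b : R)
  : set R :=
  [set x | a <= x <= b /\ exists2 y, (- eps <= y <= eps) &
     E (x * w1.1 + (F x + y) * w2.1, x * w1.2 + (F x + y) * w2.2)].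

(* Rectifiability constant R_E(eps, r, M). Intervals J = [a, b] with b - a >= r
   (endpoint type does not affect Lebesgue measure). *)
Definition rect_const (E : set (R * R)) (eps r M : R) : \bar R :=
  ereal_sup [set v : \bar R | exists (w1 w2 : R * R) (F : R -> R) (a b : R),
    [/\ (w1.1 ^+ 2 + w1.2 ^+ 2 = 1 /\ w2.1 ^+ 2 + w2.2 ^+ 2 = 1),
        w1.1 * w2.1 + w1.2 * w2.2 = 0,
        (forall x y, `|F x - F y| <= M * `|x - y|),
        r <= b - a &
        v = (@lebesgue_measure R (good_set E eps w1 w2 F a b)
             * ((b - a)^-1)%:E)%E]].

End Defs.

(* Main.v *)
(** A pair (point of [E], direction) is identified with the line through the
    point that the projection in that direction collapses.  By [S^1(E) <= L],
    [E] is replaced by finitely many tiny balls, and three kinds of pairs are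
    discarded because their lines project to a small set: lines meeting [E]
    near the point at many scales (Markov, from the coverings at [Q] coarse
    scales), lines inside over-full strips (Vitali), and an exceptional set of
    pairs of small measure.

    The last one comes from a pigeonhole.  Around each ball, fatten the set of
    remaining ("typical") directions to cells of the width of the [b]-th coarse
    scale.  These sets decrease with [b], so for some [b] they hardly change
    from [b] to [b+1], and for some scale [m] between these two coarse scales
    almost none of these directions sees [E] at distance about [r_m].  As
    strips are not over-full, the few directions that do carry little mass, so
    that at scale [m] a double cone of aperture comparable with the [b]-th
    coarse scale, hence larger than [r_m], is almost empty around each
    non-exceptional pair.  Up to a set with small projection, the part of [E]
    in each ball of the covering at scale [m] is then contained in the
    [r_(m+1)]-neighbourhood of a Lipschitz graph, and hypothesis (3) bounds its
    projection. *)
Require Import Defs.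
From HB Require Import structures.
From mathcomp Require Import all_boot all_order all_algebra.
From mathcomp Require Import all_classical all_reals all_analysis measurable_realfun.
From mathcomp Require Import ring lra zify.
Set Implicit Arguments. Unset Strict Implicit. Unset Printing Implicit Defensive.
Import Order.TTheory GRing.Theory Num.Theory.
Import numFieldNormedType.Exports.
Local Open Scope classical_set_scope.
Local Open Scope ring_scope.

(** * Covering estimates for Lebesgue outer measure on the line *)

Section LebesgueOuter.
Variable R : realType.
Implicit Types A B X : set R.

(** [lebesgue_measure] unfolds to an outer measure defined on every set, so projections of arbitrary
    pieces of [E] can be compared and added up directly. *)
Lemma lebesgue_measure_le A B :
  A `<=` B -> (lebesgue_measure A <= lebesgue_measure B)%E.
Proof.
move=> AB; rewrite /lebesgue_measure/= /lebesgue_stieltjes_measure/=.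
by rewrite /measure_extension/=; exact: le_mu_ext.
Qed.

Lemma lebesgue_measureU_le A B :
  (lebesgue_measure (A `|` B) <= lebesgue_measure A + lebesgue_measure B)%E.
Proof.
rewrite /lebesgue_measure/= /lebesgue_stieltjes_measure/=.
by rewrite /measure_extension/=; exact: outer_measureU2.
Qed.

Lemma lebesgue_measure_cover_seq (I : eqType) (s : seq I) (F : I -> set R) X :
  (forall x, X x -> exists2 i, i \in s & F i x) ->
  (lebesgue_measure X <= \sum_(i <- s) lebesgue_measure (F i))%E.
Proof.
elim: s X => [|i s IH] X cov.
  rewrite big_nil (_ : X = set0) ?measure0//.
  by apply/seteqP; split => // x /cov[].
rewrite big_cons.
have XE : X `<=` (F i) `|` (X `\` F i).
  by move=> x Xx; have [|] := pselect (F i x); [left|right].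
apply: (le_trans (lebesgue_measure_le XE)).
apply: (le_trans (lebesgue_measureU_le _ _)).
apply: leeD => //; apply: IH => x [Xx nFix].
have [j] := cov x Xx; rewrite inE => /orP[/eqP->//|js Fj].
by exists j.
Qed.

Lemma lebesgue_measure_cover (I : finType) (P : pred I) (F : I -> set R) X :
  (forall x, X x -> exists2 i, P i & F i x) ->
  (lebesgue_measure X <= \sum_(i | P i) lebesgue_measure (F i))%E.
Proof.
move=> cov; rewrite -big_filter.
apply: lebesgue_measure_cover_seq => x /cov[i Pi Fi].
by exists i => //; rewrite mem_filter Pi mem_index_enum.
Qed.

Lemma lebesgue_measure_interval_le (c r : R) X :
  0 <= r -> (forall x, X x -> `|x - c| <= r) ->
  (lebesgue_measure X <= (2 * r)%:E)%E.
Proof.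
move=> r0 Xcr; apply: (@le_trans _ _ (lebesgue_measure `[c - r, c + r])).
  apply: lebesgue_measure_le => x /Xcr; rewrite ler_distl /= in_itv /=.
  by move=> /andP[-> ->].
rewrite lebesgue_measure_itv /= lte_fin; case: ifP => _; rewrite -?EFinD lee_fin; lra.
Qed.

(** Markov's inequality for the counting function of the intervals, whose integral is their total
    length. *)
Lemma markov_count (I : finType) (c r : I -> R) (K : nat) :
  (0 < K)%N -> (forall i, 0 <= r i) ->
  (lebesgue_measure [set x : R | (K <= #|[pred i | (`|x - c i| <= r i)%R]|)%N]
     <= ((\sum_i 2 * r i) / K%:R)%:E)%E.
Proof.
move=> K0 r0.
pose J i : set R := `[c i - r i, c i + r i]%classic.
have mJ i : measurable (J i) by exact: measurable_itv.
pose f (x : R) : \bar R := (\sum_i (\1_(J i) x)%:E)%E.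
have mf1 i : measurable_fun setT (EFin \o (\1_(J i) : R -> R)).
  by apply/measurable_EFinP; exact: measurable_indic.
have mf : measurable_fun setT f.
  by apply: emeasurable_sum.
have JE i (x : R) : \1_(J i) x = ((`|x - c i| <= r i)%R : bool)%:R :> R.
  rewrite indicE; congr ((nat_of_bool _)%:R); rewrite ler_distl.
  by apply/idP/idP; rewrite inE /J /= in_itv.
have fE x : f x = (#|[pred i | (`|x - c i| <= r i)%R]|%:R)%:E.
  rewrite /f sumEFin; congr EFin; under eq_bigr do rewrite JE.
  by rewrite -natr_sum -big_mkcond /= sum1_card.
have f0 x : (0 <= f x)%E by rewrite fE lee_fin.
have -> : [set x : R | (K <= #|[pred i | (`|x - c i| <= r i)%R]|)%N] =
   setT `&` [set x | (K%:R%:E <= `|f x|)%E].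
  apply/seteqP; split => x /=.
    by move=> Kx; split => //; rewrite fE /= lee_fin ger0_norm ?ler_nat.
  by move=> []; rewrite fE /= lee_fin ger0_norm ?ler_nat.
have K0' : 0 < K%:R :> R by rewrite ltr0n.
(* Markov's inequality, with the identity as the nondecreasing function. *)
have := @le_integral_comp_abse _ _ _ (@lebesgue_measure R) _ measurableT
  f K%:R idfun (@measurable_id _ _ _) (fun _ h => h) (fun _ _ _ _ h => h) mf K0'.
under eq_integral do rewrite gee0_abs//.
rewrite ge0_integral_sum//.
rewrite EFinM lee_pdivlMr// muleC => /le_trans; apply.
rewrite -sumEFin; apply: lee_sum => i _.
rewrite integral_indic//; last exact: mJ.
by apply: (@lebesgue_measure_interval_le (c i)) => // x; rewrite /J /= in_itv/= ler_distl => -[].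
Qed.

(** Vitali selects disjoint intervals whose threefold enlargements still cover [X]. Each carries
    mass at least [A * w i], and disjointness lets every weight be charged only once. *)
Lemma vitali_density (I : finType) (P : pred I) (c w wt : I -> R) (A : R) X :
  0 < A -> (forall i, 0 <= wt i) -> (forall i, P i -> 0 < w i) ->
  (forall i, P i -> A * w i <= \sum_(j | `|c j - c i| <= w i) wt j) ->
  (forall x, X x -> exists2 i, P i & `|x - c i| <= w i) ->
  (lebesgue_measure X <= (12 / A * \sum_i wt i)%:E)%E.
Proof.
move=> A0 wt0 w0 dens cov.
(* The Vitali lemma asks for genuine balls at all indices, hence the dummy radius 1 outside [P]. The
   factor 2 below places each closed interval inside an open ball; tripling then gives the radius
   [6 * w i] and the constant 12. *)
pose w' i := if P i then w i else 1.
have w'0 i : 0 < w' i by rewrite /w'; case: ifP => // /w0.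
pose B i := ball (c i) (2 * w' i).
have B0 i : 0 < 2 * w' i by rewrite mulr_gt0.
have ballB i : is_ball (B i) by exact: is_ball_ball.
have B_nonempty i : B i !=set0 by exists (c i); exact: ballxx.
have [D [uD Ds tD covD]] :=
  vitali_lemma_finite_cover ballB B_nonempty (enum P).
have DP i : i \in D -> P i by move=> /Ds; rewrite mem_enum.
have Xcov x : X x -> exists2 i, i \in D & `|x - c i| <= 6 * w i.
  move=> /cov[i Pi xi].
  have : cover [set` enum P] B x.
    exists i; first by rewrite /= mem_enum.
    rewrite /B /ball /= distrC (le_lt_trans xi)// /w' Pi.
    by rewrite ltr_pMl ?w0// ltr1n.
  move=> /covD[j /= Dj]; rewrite /B /= scale_ballE// /ball/= => xj.
  exists j => //; rewrite distrC (le_trans (ltW xj))//.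
  by rewrite /w' DP// mulrA -natrM.
pose F i := [set x | `|x - c i| <= 6 * w i].
apply: (le_trans (@lebesgue_measure_cover_seq _ D F _ Xcov)).
apply: (@le_trans _ _ (\sum_(i <- D) (12 / A * \sum_(j | `|c j - c i| <= w i) wt j)%:E)%E).
  rewrite big_seq [leRHS]big_seq; apply: lee_sum => i iD.
  apply: (@le_trans _ _ ((2 * (6 * w i))%:E)).
    by apply: (@lebesgue_measure_interval_le (c i)) => //; rewrite mulr_ge0// ltW ?w0 ?DP.
  rewrite lee_fin; have := dens _ (DP _ iD).
  move: (\sum_(j | _) wt j) => S h.
  by rewrite mulrAC ler_pdivlMr//; lra.
have A12 : 0 <= 12 / A by rewrite divr_ge0 ?ltW.
rewrite sumEFin lee_fin -mulr_sumr ler_wpM2l//.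
under eq_bigr do rewrite big_mkcond.
rewrite exchange_big /=; apply: ler_sum => j _.
(* At most one selected interval contains [c j], so [wt j] occurs at most once in the double sum. *)
have [/hasP[i iD ij]|/hasPn nh] := boolP (has (fun i => `|c j - c i| <= w i) D); last first.
  by rewrite big_seq big1// => i /nh/negbTE ->.
rewrite (bigD1_seq i)//= ij big_seq_cond big1 ?addr0// => k /andP[kD ki].
case: ifP => // jk; exfalso; move/eqP: ki; apply.
apply: (tD k i) => //; exists (c j).
have lt2 l : l \in D -> w l < 2 * w l by move=> /DP/w0; lra.
by split; rewrite /B /ball /= distrC /w' DP// (le_lt_trans _ (lt2 _ _)).
Qed.

(* Sweep [P] from the left: each step consumes the two-sided neighbourhood of a
   point almost leftmost in what remains, and only its right half is charged,
   so the charged intervals are disjoint. *)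
Lemma greedy_density (P : set R) (a b tm tM kap : R) :
  0 < tm -> 0 <= kap -> (forall x, P x -> a <= x <= b) ->
  (forall x, P x -> exists t, [/\ tm <= t <= tM &
     (lebesgue_measure (P `&` [set y | (`|y - x| <= t)%R]) <= (kap * t)%:E)%E]) ->
  (lebesgue_measure P <= (kap * Num.max 0 (b + tM - a))%:E)%E.
Proof.
move=> tm0 kap0 Pab dens.
(* Every step of the sweep advances by at least [tm], so [n] bounds the number of steps still
   possible. *)
have key n x : b + tM - x <= n%:R * tm ->
  (lebesgue_measure (P `&` [set y | (x <= y)%R]) <= (kap * Num.max 0 (b + tM - x))%:E)%E.
  elim: n x => [|n IH] x xn.
    have [[y [Py /= xy]]|Pe] := pselect (P `&` [set y | (x <= y)%R] !=set0).
      have [t [/andP[t1 t2] _]] := dens _ Py; have /andP[_ yb] := Pab _ Py.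
      by exfalso; move: xn; rewrite mul0r; lra.
    rewrite (_ : _ `&` _ = set0).
      by rewrite measure0 lee_fin mulr_ge0// le_max lexx.
    by apply/seteqP; split => // y Py; apply: Pe; exists y.
  set Q := P `&` _.
  have [Qne|Pe] := pselect (Q !=set0); last first.
    rewrite (_ : Q = set0).
      by rewrite measure0 lee_fin mulr_ge0// le_max lexx.
    by apply/seteqP; split => // y Py; apply: Pe; exists y.
  have hiQ : has_inf Q by split => //; exists x => y [].
  have [p [Pp /= xp] pinf] := inf_adherent tm0 hiQ.
  have [t [/andP[t1 t2] Ht]] := dens _ Pp.
  have /andP[_ pb] := Pab _ Pp.
  have sub : Q `<=` (P `&` [set y | (`|y - p| <= t)%R]) `|`
                    (P `&` [set y | (p + t <= y)%R]).
    move=> y [Py /= xy].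
    have infy : inf Q <= y by apply: ge_inf; [exact: hiQ.2|split].
    have [pty|pty] := leP (p + t) y; [by right|left].
    by split => //=; rewrite ler_distl; apply/andP; split; lra.
  apply: (le_trans (lebesgue_measure_le sub)).
  apply: (le_trans (lebesgue_measureU_le _ _)).
  have {}IH := IH (p + t); apply: (le_trans (leeD Ht (IH _))).
    by move: xn; rewrite -natr1 mulrDl mul1r; lra.
  rewrite -EFinD lee_fin -mulrDr ler_wpM2l//.
  rewrite (max_idPr _); last by lra.
  by rewrite le_max; apply/orP; right; lra.
have [n nP] : exists n : nat, b + tM - a <= n%:R * tm.
  exists (Num.truncn ((b + tM - a) / tm)).+1.
  by rewrite -ler_pdivrMr// ltW// truncnS_gt.
apply: le_trans (key n a nP); apply: lebesgue_measure_le => x Px; split => //=.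
by have /andP[] := Pab _ Px.
Qed.

End LebesgueOuter.

(** * Rotated coordinates and double cones in the plane *)

Section PlaneGeometry.
Variable R : realType.
Implicit Types (x y z : R * R) (s t : R).

(** [dot t] and [perp t] are the coordinates in the frame rotated by [t]; the fibres of [dot t] are
    the lines counted by the Favard length. Distances are measured in the l^1 norm [dist1], which
    avoids square roots and costs only constants. *)
Definition dot t x : R := x.1 * cos t + x.2 * sin t.
Definition perp t x : R := x.2 * cos t - x.1 * sin t.
Definition dist1 x y : R := `|x.1 - y.1| + `|x.2 - y.2|.

(* The double cone with vertex [x] swept by the lines normal to directions in
   the interval [s, t]: the linear form [dot _ (y - x)] changes sign on it. *)
Definition cone s t x y : bool := (dot s y - dot s x) * (dot t y - dot t x) <= 0.

Lemma lipschitz1_of_deriv (f df : R -> R) s t :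
  (forall u : R, is_derive u 1 f (df u)) -> (forall u : R, `|df u| <= 1) ->
  `|f s - f t| <= `|s - t|.
Proof.
move=> fdf df1; wlog ts : s t / t <= s.
  move=> H; have [/H//|/ltW/H] := leP t s.
  by rewrite distrC [leRHS]distrC.
have cf : {within `[t, s], continuous f}.
  apply: derivable_within_continuous => u _; exact: ex_derive.
have [c _ ->] := MVT_segment ts (fun (u : R) _ => fdf u) cf.
by rewrite normrM ler_piMl.
Qed.

Lemma cos_lipschitz s t : `|cos s - cos t| <= `|s - t|.
Proof.
apply: (@lipschitz1_of_deriv _ (fun u => - sin u)) => u.
by rewrite normrN sin_max.
Qed.

Lemma sin_lipschitz s t : `|sin s - sin t| <= `|s - t|.
Proof.
apply: (@lipschitz1_of_deriv _ cos) => x.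
exact: cos_max.
Qed.

Lemma sin_ge_half t : 0 <= t <= 1 / 2 -> t / 2 <= sin t.
Proof.
move=> /andP[t0 t1].
have cf : {within `[0, t], continuous (@sin R)}.
  apply: derivable_within_continuous => u _; exact: ex_derive.
have [c] := MVT_segment t0 (fun (u : R) _ => @is_derive_sin _ u) cf.
rewrite in_itv /= => /andP[c0 ct]; rewrite sin0 !subr0 => ->.
have := cos_lipschitz c 0; rewrite cos0 subr0 ler_distl (ger0_norm c0) => /andP[h _].
nra.
Qed.

Lemma dist1C x y : dist1 x y = dist1 y x.
Proof. by rewrite /dist1 (distrC x.1) (distrC x.2). Qed.

Lemma dist1_ge0 x y : 0 <= dist1 x y.
Proof. by rewrite addr_ge0. Qed.

Lemma dist1_triangle y x z : dist1 x z <= dist1 x y + dist1 y z.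
Proof.
rewrite /dist1 (_ : x.1 - z.1 = (x.1 - y.1) + (y.1 - z.1)); last by ring.
rewrite (_ : x.2 - z.2 = (x.2 - y.2) + (y.2 - z.2)); last by ring.
have := ler_normD (x.1 - y.1) (y.1 - z.1).
have := ler_normD (x.2 - y.2) (y.2 - z.2).
lra.
Qed.

Lemma norm_mul_le1 (a b : R) : `|b| <= 1 -> `|a * b| <= `|a|.
Proof. by move=> b1; rewrite normrM ler_piMr. Qed.

Lemma dotB t x y :
  dot t x - dot t y = (x.1 - y.1) * cos t + (x.2 - y.2) * sin t.
Proof. by rewrite /dot; ring. Qed.

Lemma perpB t x y :
  perp t x - perp t y = (x.2 - y.2) * cos t - (x.1 - y.1) * sin t.
Proof. by rewrite /perp; ring. Qed.

Lemma perp_le_dist1 t x y : `|perp t x - perp t y| <= dist1 x y.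
Proof.
rewrite perpB /dist1 (le_trans (ler_normB _ _))// [leRHS]addrC lerD// norm_mul_le1 ?sin_max//.
exact: cos_max.
Qed.

Lemma dot_angle_le s t x y :
  `|(dot s x - dot s y) - (dot t x - dot t y)| <= dist1 x y * `|s - t|.
Proof.
rewrite !dotB (_ : _ - _ = (x.1 - y.1) * (cos s - cos t)
                      + (x.2 - y.2) * (sin s - sin t)); last by ring.
rewrite (le_trans (ler_normD _ _))// /dist1 [leRHS]mulrDl !normrM.
by rewrite lerD// ler_wpM2l// ?cos_lipschitz ?sin_lipschitz.
Qed.

Lemma coord_dot_perp t x :
  x = (dot t x * cos t + perp t x * - sin t, dot t x * sin t + perp t x * cos t).
Proof.
have h : cos t ^+ 2 + sin t ^+ 2 = 1 by rewrite cos2Dsin2.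
case: x => a b; rewrite /dot /perp /=; congr (_, _).
  by rewrite -[LHS]mulr1 -h; ring.
by rewrite -[LHS]mulr1 -h; ring.
Qed.

Lemma dist1_le_dot_perp t x y :
  dist1 x y <= 2 * (`|dot t x - dot t y| + `|perp t x - perp t y|).
Proof.
set u := _ - dot t y; set v := _ - perp t y.
have h1 : x.1 - y.1 = u * cos t - v * sin t.
  by rewrite {1}(coord_dot_perp t x) {1}(coord_dot_perp t y) /= /u /v; ring.
have h2 : x.2 - y.2 = u * sin t + v * cos t.
  by rewrite {1}(coord_dot_perp t x) {1}(coord_dot_perp t y) /= /u /v; ring.
rewrite /dist1 h1 h2.
have := ler_normB (u * cos t) (v * sin t).
have := ler_normD (u * sin t) (v * cos t).
have := norm_mul_le1 u (cos_max t); have := norm_mul_le1 v (cos_max t).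
have := norm_mul_le1 u (sin_max t); have := norm_mul_le1 v (sin_max t).
lra.
Qed.

Lemma dot_perp_sqr t x y :
  (dot t x - dot t y) ^+ 2 + (perp t x - perp t y) ^+ 2
    = (x.1 - y.1) ^+ 2 + (x.2 - y.2) ^+ 2.
Proof.
rewrite dotB perpB; have h := cos2Dsin2 t.
rewrite (_ : _ + _ = ((x.1 - y.1) ^+ 2 + (x.2 - y.2) ^+ 2)
   * (cos t ^+ 2 + sin t ^+ 2)); last by ring.
by rewrite h mulr1.
Qed.

Lemma norm_lt_of_sqr (a b r : R) : 0 <= r -> a ^+ 2 + b ^+ 2 < r ^+ 2 -> `|a| < r.
Proof.
move=> r0 h; rewrite -(ger0_norm r0) -ltr_sqr ?nnegrE// !real_normK ?num_real//.
by rewrite (le_lt_trans _ h)// lerDl sqr_ge0.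
Qed.

Lemma eball_dot t c (r : R) x : 0 <= r -> eball c r x -> `|dot t x - dot t c| < r.
Proof. by move=> r0; rewrite /eball /= -(dot_perp_sqr t) => /(norm_lt_of_sqr r0). Qed.

Lemma eball_perp t c (r : R) x : 0 <= r -> eball c r x -> `|perp t x - perp t c| < r.
Proof.
by move=> r0; rewrite /eball /= -(dot_perp_sqr t) addrC => /(norm_lt_of_sqr r0).
Qed.

Lemma eball_dist1 c (r : R) x : 0 <= r -> eball c r x -> dist1 x c <= 2 * r.
Proof.
move=> r0; rewrite /eball /dist1 /= => h.
have := norm_lt_of_sqr r0 h; rewrite addrC in h; have := norm_lt_of_sqr r0 h.
lra.
Qed.

(** A form that changes sign between [s1] and [s2] changes sign on one side of [t]. This makes the
    mass of a cone subadditive under bisection of its angular cell. *)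
Lemma cone_split t s1 s2 x y : cone s1 s2 x y -> cone s1 t x y \/ cone t s2 x y.
Proof.
rewrite /cone; move: (dot s1 y - _) (dot t y - _) (dot s2 y - _) => a b c ac.
by have [ab|ab] := leP (a * b) 0; [left|right; nra].
Qed.

(** The values at [s1] and [s2] have opposite signs and both lie within [dist1 x y * d] of the value
    at [t]. Thus a thin cone lies in a strip around the line normal to [t]. *)
Lemma cone_dot_le t s1 s2 x y d :
  cone s1 s2 x y -> `|t - s1| <= d -> `|t - s2| <= d ->
  `|dot t y - dot t x| <= dist1 x y * d.
Proof.
rewrite /cone => c h1 h2.
have := dot_angle_le t s1 y x; have := dot_angle_le t s2 y x.
rewrite (dist1C y x) => k2 k1.
have {}k1 := le_trans k1 (ler_wpM2l (dist1_ge0 x y) h1).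
have {}k2 := le_trans k2 (ler_wpM2l (dist1_ge0 x y) h2).
move: c k1 k2; move: (dist1 x y * d) => D.
move: (dot t y - _) (dot s1 y - _) (dot s2 y - _) => a b c bc.
rewrite !ler_distl ler_norml => /andP[k1 k1'] /andP[k2 k2'].
have [b0|b0] := leP 0 b; have [c0|c0] := leP 0 c; apply/andP; split; nra.
Qed.

Lemma dotD s t x y : dot (t + s) y - dot (t + s) x
  = cos s * (dot t y - dot t x) + sin s * (perp t y - perp t x).
Proof. by rewrite /dot /perp cosD sinD; ring. Qed.

(** A converse to [cone_dot_le]: a rotation by at least [d] either way adds a multiple of the [perp]
    difference by a sine of size at least [d / 2]. This outweighs the [dot] difference, so the end
    values have opposite signs. *)
Lemma cone_of_slope t s1 s2 d x y :
  0 <= d <= s1 -> s1 <= 1 / 2 -> d <= s2 <= 1 / 2 ->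
  `|dot t y - dot t x| <= d / 2 * `|perp t y - perp t x| ->
  cone (t - s1) (t + s2) x y.
Proof.
move=> /andP[d0 ds1] s11 /andP[ds2 s21].
rewrite /cone !dotD cosN sinN.
have sin1 : s1 / 2 <= sin s1 by apply: sin_ge_half; lra.
have sin2 : s2 / 2 <= sin s2 by apply: sin_ge_half; lra.
have cge s : 0 <= s <= 1 / 2 -> 0 <= cos s <= 1.
  move=> hs; have := cos_lipschitz s 0; rewrite cos0 subr0 ler_distl.
  by rewrite ger0_norm; move: (cos_le1 s) hs; lra.
have c1 : 0 <= cos s1 <= 1 by apply: cge; lra.
have c2 : 0 <= cos s2 <= 1 by apply: cge; lra.
move: (cos s1) (cos s2) (sin s1) (sin s2) c1 c2 sin1 sin2.
move: (dot t y - _) (perp t y - _) => u w a b e f /andP[a0 a1] /andP[b0 b1] he hf uw.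
have h1 : `|a * u| <= e * `|w|.
  rewrite normrM (ger0_norm a0).
  have : a * `|u| <= `|u| by rewrite ler_piMl.
  have : d / 2 * `|w| <= e * `|w| by rewrite ler_wpM2r//; lra.
  lra.
have h2 : `|b * u| <= f * `|w|.
  rewrite normrM (ger0_norm b0).
  have : b * `|u| <= `|u| by rewrite ler_piMl.
  have : d / 2 * `|w| <= f * `|w| by rewrite ler_wpM2r//; lra.
  lra.
move: h1 h2; rewrite !ler_norml => /andP[h1 h1'] /andP[h2 h2'].
have [w0|w0] := leP 0 w.
  rewrite (ger0_norm w0) in h1 h1' h2 h2'.
  by apply: mulr_le0_ge0; lra.
rewrite (ltr0_norm w0) in h1 h1' h2 h2'.
by apply: mulr_ge0_le0; lra.
Qed.

End PlaneGeometry.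

(** * Dyadic cells of directions and their counting *)

Section DyadicCells.
Local Open Scope set_scope.
Variables (n : nat).
Implicit Types (k c a : nat) (S T : {set 'I_(2 ^ n)}).

Definition cell k a := (a %/ 2 ^ (n - k))%N.

Definition cell_set k c := [set a : 'I_(2 ^ n) | cell k a == c].

Definition adjacent c c' := (c <= c'.+1)%N && (c' <= c.+1)%N.

Lemma adjacentC c c' : adjacent c c' = adjacent c' c.
Proof. by rewrite /adjacent andbC. Qed.

(** The fattening of [S] at level [k]. Neighbouring cells are included because a double cone around
    a direction of [S] spills over into them. *)
Definition near S k c := [exists a : 'I_(2 ^ n), (a \in S) && adjacent (cell k a) c].

Lemma leq_card_cell k c : (#|cell_set k c| <= 2 ^ (n - k))%N.
Proof.
have W0 : (0 < 2 ^ (n - k))%N by rewrite expn_gt0.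
pose f (a : 'I_(2 ^ n)) := Ordinal (ltn_pmod a W0).
rewrite -[leqRHS]card_ord -(@card_in_imset _ _ f); first exact: max_card.
move=> a b; rewrite !inE => /eqP ac /eqP bc /(congr1 val) /= ab.
apply: val_inj; rewrite /= (divn_eq a (2 ^ (n - k))%N) ab -/(cell k a) ac -bc.
by rewrite -divn_eq.
Qed.

Lemma card_cell k c : (k <= n)%N -> (c < 2 ^ k)%N -> #|cell_set k c| = (2 ^ (n - k))%N.
Proof.
move=> kn ck; apply/eqP; rewrite eqn_leq leq_card_cell /=.
have W0 : (0 < 2 ^ (n - k))%N by rewrite expn_gt0.
have lt_ (j : 'I_(2 ^ (n - k))) : (c * 2 ^ (n - k) + j < 2 ^ n)%N.
  apply: (@leq_trans (c.+1 * 2 ^ (n - k))%N); first by rewrite mulSn addnC ltn_add2r.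
  by rewrite -{2}(subnKC kn) expnD leq_mul2r ck orbT.
pose f j := Ordinal (lt_ j).
have finj : injective f.
  by move=> i j /(congr1 val) /= /addnI /val_inj.
rewrite -{1}[(2 ^ (n - k))%N]card_ord -(card_imset _ finj) subset_leq_card//.
apply/fintype.subsetP => _ /imsetP[j _ ->]; rewrite inE /cell /f /= divnMDl// divn_small//.
by rewrite addn0.
Qed.

Lemma cell_half k a : (k < n)%N -> cell k a = (cell k.+1 a)./2.
Proof.
by move=> kn; rewrite /cell -(subnSK kn) expnSr divnMA divn2.
Qed.

Lemma near_half S k c : (k < n)%N -> near S k.+1 c -> near S k c./2.
Proof.
move=> kn /existsP[a /andP[aS adj]]; apply/existsP; exists a; rewrite aS /=.
move: adj; rewrite /adjacent (cell_half _ kn) => /andP[h1 h2].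
apply/andP; split.
  by rewrite (leq_trans (half_leq h1))//= uphalf_half; case: (odd c).
by rewrite (leq_trans (half_leq h2))//= uphalf_half; case: (odd (cell _ _)).
Qed.

(** Halving keeps cells equal or adjacent, so the fattenings decrease as the level grows. The
    pigeonhole rests on this monotonicity. *)
Lemma near_cell_anti S k k' a : (k <= k' <= n)%N ->
  near S k' (cell k' a) -> near S k (cell k a).
Proof.
move=> /andP[+ k'n]; move: k'n; elim: k' => [|k' IH] k'n.
  by rewrite leqn0 => /eqP ->.
rewrite leq_eqVlt => /orP[/eqP -> //|]; rewrite ltnS => kk' /(near_half k'n).
by rewrite -(cell_half _ k'n); apply: IH => //; exact: ltnW.
Qed.

Lemma mem_near S k (a : 'I_(2 ^ n)) : a \in S -> near S k (cell k a).
Proof. by move=> aS; apply/existsP; exists a; rewrite aS /adjacent leqnSn. Qed.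

(** The leaves that spoil an empty cone: those leaving the fattening between levels [k0] and [k1],
    and those remaining in it whose cell at level [k1] is hit. *)
Definition sparse_leaves S k0 k1 (hit : pred nat) :=
  [set a : 'I_(2 ^ n) | near S k0 (cell k0 a) && ~~ near S k1 (cell k1 a)
                     || near S k1 (cell k1 a) && hit (cell k1 a)].

Section DyadicBound.
Variables (R : realType) (g : nat -> nat -> R) (B : R).
Variables (S : {set 'I_(2 ^ n)}) (k0 k1 : nat) (hit : pred nat).
Hypothesis B0 : 0 <= B.
Hypothesis k1n : (k1 <= n)%N.
Let T := sparse_leaves S k0 k1 hit.
Hypothesis g_split : forall k c, (k0 <= k < k1)%N -> g k c <= g k.+1 c.*2 + g k.+1 c.*2.+1.
Hypothesis g_near : forall k c, (k0 <= k <= k1)%N -> near S k c ->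
  g k c <= B * (2 ^ (n - k))%N%:R.
Hypothesis g_child : forall k c, (k0 <= k < k1)%N -> near S k c./2 ->
  g k.+1 c <= B * (2 ^ (n - k))%N%:R.
Hypothesis g_nohit : forall c, near S k1 c -> ~~ hit c -> g k1 c <= 0.

Lemma full_cell k c : (k0 <= k <= k1)%N -> (c < 2 ^ k)%N ->
  (forall a : 'I_(2 ^ n), cell k a = c -> a \in T) ->
  #|T :&: cell_set k c| = (2 ^ (n - k))%N.
Proof.
move=> /andP[_ kk] ck cT; rewrite -(@card_cell k c)// ?(leq_trans kk)//.
congr #|pred_of_set _|; apply/finset.setIidPr/fintype.subsetP => a.
by rewrite inE => /eqP /cT.
Qed.

Lemma split_cell k c : (k < n)%N ->
  #|T :&: cell_set k c| =
  (#|T :&: cell_set k.+1 c.*2| + #|T :&: cell_set k.+1 c.*2.+1|)%N.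
Proof.
move=> kn; rewrite -cardsUI [X in (_ + X)%N](_ : _ = 0)%N ?addn0.
  congr #|pred_of_set _|; apply/setP => a; rewrite -finset.setIUr !finset.in_setI.
  by congr (_ && _); rewrite finset.in_setU !finset.in_set (cell_half _ kn); lia.
apply: eq_card0 => a; rewrite !finset.in_setI !finset.in_set.
by apply/negP => /andP[/andP[_ /eqP ->] /andP[_ /eqP]]; lia.
Qed.

(* Descend the dyadic tree until a cell is no longer near [S]: all its leaves
   belong to [T], and its parent, still near [S], bounds [g] there. *)
Lemma dyadic_bound c : (k0 <= k1)%N -> (c < 2 ^ k0)%N -> near S k0 c ->
  g k0 c <= 2 * B * (#|T :&: cell_set k0 c|)%:R.
Proof.
move=> k01 ck0 nc.
suff H d k e : (k + d = k1)%N -> (k0 <= k)%N -> (e < 2 ^ k)%N -> near S k e ->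
    g k e <= 2 * B * (#|T :&: cell_set k e|)%:R.
  by apply: (H (k1 - k0)%N) => //; rewrite subnKC.
elim: d k e => [|d IH] k e.
  rewrite addn0 => -> _ ek ne.
  have [he|he] := boolP (hit e); last first.
    by rewrite (le_trans (g_nohit ne he))// !mulr_ge0.
  rewrite full_cell ?k01 ?leqnn//; last first.
    by move=> a ae; rewrite inE ae ne he orbT.
  have := g_near (k := k1) (c := e); rewrite k01 leqnn => /(_ isT ne) h.
  rewrite (le_trans h)// -mulrA ler_peMl ?ler1n// mulr_ge0//.
move=> kd k0k ek ne.
have kk1 : (k < k1)%N by rewrite -kd -addSnnS leq_addr.
have kn : (k < n)%N by apply: leq_trans k1n.
have child f : f./2 = e -> g k.+1 f <= 2 * B * (#|T :&: cell_set k.+1 f|)%:R.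
  move=> fe.
  have fk : (f < 2 ^ k.+1)%N.
    rewrite -(odd_double_half f) fe expnS mul2n.
    apply: (@leq_trans e.+1.*2); last by rewrite leq_double.
    by rewrite doubleS; case: odd => //=.
  have [nf|nf] := boolP (near S k.+1 f).
    by apply: IH => //; [rewrite addSnnS|exact: leqW].
  rewrite full_cell//; first last.
  - move=> a af; rewrite inE; apply/orP; left; apply/andP; split.
      apply: (@near_cell_anti _ _ k); first by rewrite k0k ltnW.
      by rewrite (cell_half _ kn) af fe.
    apply: contra nf => /(near_cell_anti _).
    by move=> /(_ k.+1); rewrite af; apply; rewrite kk1.
  - by rewrite (leq_trans k0k).
  (* The parent has twice as many leaves as the child; this is the factor 2 of the bound. *)
  rewrite (le_trans (@g_child k f _ _)) ?fe ?k0k//.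
  by rewrite -(subnSK kn) expnS natrM mulrCA mulrA.
rewrite split_cell// natrD mulrDr (le_trans (g_split _ _)) ?k0k//.
by rewrite lerD// child//= ?doubleK// uphalf_double.
Qed.

End DyadicBound.

Lemma card_adjacent k c : (#|[set a : 'I_(2 ^ n) | adjacent (cell k a) c]| <= 3 * 2 ^ (n - k))%N.
Proof.
apply: (@leq_trans #|cell_set k c.-1 :|: cell_set k c :|: cell_set k c.+1|).
  apply: subset_leq_card; apply/fintype.subsetP => a; rewrite !inE /adjacent.
  move: (cell k a) => d /andP[h1 h2].
  case: (ltngtP d c) => [dc|dc|->]; rewrite ?orbT//.
    by rewrite [d == c.-1](_ : _ = true)//; apply/eqP; case: c h1 h2 dc => //= c' *; apply/eqP; rewrite eqn_leq; apply/andP; split.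
  by rewrite [d == c.+1](_ : _ = true) ?orbT//; apply/eqP/eqP; rewrite eqn_leq h1.
apply: (leq_trans (leq_card_setU _ _)).
rewrite mulSn mulSn mul1n addnA leq_add ?leq_card_cell//.
by rewrite (leq_trans (leq_card_setU _ _))// leq_add ?leq_card_cell.
Qed.

(** Double counting of adjacent pairs: each counted [a] has more than [eta * 2 ^ (n - k)] partners
    in [T], while each [b] in [T] has at most [3 * 2 ^ (n - k)] partners, from three cells. *)
Lemma exceptional_card (R : realType) (T : {set 'I_(2 ^ n)}) k (eta : R) (S : {set 'I_(2 ^ n)}) :
  0 < eta ->
  (#|[set a in S | (eta * (2 ^ (n - k))%N%:R <
     (#|[set b in T | adjacent (cell k b) (cell k a)]|)%:R)%R]|)%:R
   <= 3 / eta * #|T|%:R :> R.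
Proof.
move=> eta0; set E := [set a in S | _].
have W0 : 0 < (2 ^ (n - k))%N%:R :> R by rewrite ltr0n expn_gt0.
rewrite mulrAC ler_pdivlMr//.
rewrite -(ler_pM2r W0) -mulrA.
apply: (@le_trans _ _ (\sum_(a in E) (#|[set b in T | adjacent (cell k b) (cell k a)]|)%:R)).
  rewrite -sum1_card natr_sum mulr_suml; apply: ler_sum => a.
  by rewrite inE mul1r => /andP[_ /ltW].
rewrite -natr_sum -!natrM ler_nat.
under eq_bigr do rewrite -sum1_card.
rewrite (exchange_big_dep (mem T)) /=; last by move=> a b _; rewrite inE => /andP[].
rewrite -sum1_card big_distrr big_distrl /=; apply: leq_sum => b _.
rewrite sum1_card muln1 (leq_trans _ (card_adjacent k (cell k b)))//.
apply: subset_leq_card; apply/fintype.subsetP => a.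
rewrite unfold_in finset.in_set => /andP[_]; rewrite finset.in_set => /andP[_].
by rewrite adjacentC.
Qed.

(** The condition [0 < c] keeps [c.-1] distinct from [c], so the three cells are disjoint. *)
Lemma card_three_cells k c T : (0 < c)%N ->
  (#|T :&: cell_set k c.-1| + (#|T :&: cell_set k c| + #|T :&: cell_set k c.+1|)
    <= #|[set b in T | adjacent (cell k b) c]|)%N.
Proof.
have cE (X : {set 'I_(2 ^ n)}) : #|X| = (\sum_b (b \in X))%N.
  by rewrite -sum1_card big_mkcond; apply: eq_bigr => b _; case: (b \in X).
move=> c0; rewrite !cE -!big_split /=; apply: leq_sum => b _.
rewrite !finset.in_setI !finset.in_set /adjacent.
by case: (b \in T) => //=; move: (cell k b) => d; lia.
Qed.

End DyadicCells.

Lemma exists_le_average (R : realType) (D : nat) (f : 'I_D -> R) (X : R) :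
  (0 < D)%N -> \sum_i f i <= X -> exists i, f i <= X / D%:R.
Proof.
move=> D0 fX; apply: contrapT => /forallNP H.
have : \sum_(i < D) (X / D%:R) < \sum_i f i.
  apply: ltr_sum => [|i _]; last by rewrite ltNge; apply/negP/H.
  by apply/hasP; exists (Ordinal D0); rewrite ?mem_index_enum.
have D0' : D%:R != 0 :> R by rewrite pnatr_eq0 -lt0n.
rewrite sumr_const card_ord -[X in X < _]mulr_natr (divfK D0').
by move=> /lt_le_trans /(_ fX); rewrite ltxx.
Qed.

(** * Lipschitz graphs and steep pairs *)

Section SteepPairs.
Variables (R : realType) (t s eps : R) (X : set (R * R)).

(** Steep pairs are the obstruction to lying within [eps] of a graph of Lipschitz constant [s^-1]
    over the [dot t] axis. *)
Definition steep (x y : R * R) :=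
  `|dot t y - dot t x| <= s * `|perp t y - perp t x| /\
  eps <= `|perp t y - perp t x|.

Definition flat_part := [set x | X x /\ forall y, X y -> ~ steep x y].

(* McShane extension of the partial function [dot t x |-> perp t x]. *)
Lemma flat_part_graph (b : R) : 0 < s -> 0 < eps -> (forall x, X x -> b <= perp t x) ->
  exists F : R -> R, (forall u v, `|F u - F v| <= s^-1 * `|u - v|) /\
    forall x, flat_part x -> `|perp t x - F (dot t x)| <= eps.
Proof.
move=> s0 eps0 Xb.
have [[x0 Gx0]|Ge] := pselect (flat_part !=set0); last first.
  exists (fun=> 0); split=> [u v|x Gx].
    by rewrite subrr normr0 mulr_ge0// invr_ge0 ltW.
  by exfalso; apply: Ge; exists x.
have is0 : 0 < s^-1 by rewrite invr_gt0.
pose f u x := perp t x + s^-1 * `|u - dot t x|.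
pose V u := [set f u x | x in flat_part].
have hV u : has_inf (V u).
  split; first by exists (f u x0); exists x0.
  exists b => _ [x [Xx _] <-]; rewrite /f (le_trans (Xb _ Xx))// lerDl.
  by rewrite mulr_ge0// ltW.
have FLip u v : inf (V u) <= inf (V v) + s^-1 * `|u - v|.
  rewrite -lerBlDr; apply: lb_le_inf; first exact: (hV v).1.
  move=> _ [x Gx <-]; rewrite lerBlDr.
  apply: (@le_trans _ _ (f u x)).
    by apply: ge_inf; [exact: (hV u).2|exists x].
  have : s^-1 * `|u - dot t x| <= s^-1 * (`|u - v| + `|v - dot t x|).
    by rewrite ler_pM2l// (le_trans _ (ler_normD _ _))// subrKA.
  by rewrite /f mulrDr; lra.
exists (fun u => inf (V u)); split=> [u v|x Gx] /=.
  rewrite ler_norml; apply/andP; split.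
    by have := FLip v u; rewrite (distrC v); lra.
  by have := FLip u v; lra.
rewrite ler_norml; apply/andP; split.
  have : inf (V (dot t x)) <= f (dot t x) x.
    by apply: ge_inf; [exact: (hV _).2|exists x].
  by rewrite /f subrr normr0 mulr0; lra.
rewrite lerBlDr -lerBlDl; apply: lb_le_inf; first exact: (hV _).1.
move=> _ [y [Xy _] <-]; rewrite /f lerBlDl.
(* A pair that is not steep either obeys the Lipschitz bound or is closer than [eps] in the [perp]
   coordinate; in both cases at most [eps] is lost. *)
have [yx|yx] := leP eps `|perp t y - perp t x|.
  have : ~ steep x y by exact: Gx.2.
  move=> /not_andP[/negP|/negP]; last by rewrite yx.
  rewrite -ltNge (distrC (dot t y)) => h.
  have : `|perp t y - perp t x| <= s^-1 * `|dot t x - dot t y|.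
    by rewrite ler_pdivlMl// ltW.
  by rewrite ler_norml => /andP[h1 h2]; lra.
have : 0 <= s^-1 * `|dot t x - dot t y| by rewrite mulr_ge0// ltW.
by move: yx; rewrite ltr_norml => /andP[h1 h2]; lra.
Qed.

(** The graph through the flat part, in the frame rotated by [t] and over the interval of radius
    [rho] about [c], is a competitor in the supremum defining [rect_const]. *)
Lemma rect_const_flat_part (E : set (R * R)) (r M c rho kap b : R) :
  0 < s -> 0 < eps ->
  (rect_const E eps r M <= kap%:E)%E -> s^-1 <= M -> X `<=` E ->
  0 < rho -> r <= 2 * rho ->
  (forall x, X x -> `|dot t x - c| <= rho) ->
  (forall x, X x -> b <= perp t x) ->
  (lebesgue_measure (dot t @` flat_part) <= (2 * rho * kap)%:E)%E.
Proof.
move=> s0 eps0 RE sM XE rho0 rrho Xc /(flat_part_graph s0 eps0)[F [FL FG]].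
pose w1 := (cos t, sin t); pose w2 := (- sin t, cos t).
have rho2 : 0 < c + rho - (c - rho) by lra.
have : (lebesgue_measure (good_set E eps w1 w2 F (c - rho) (c + rho))
        * ((c + rho - (c - rho))^-1)%:E <= kap%:E)%E.
  apply: le_trans RE; apply: ereal_sup_ubound.
  exists w1, w2, F, (c - rho), (c + rho); split => //=.
  - by split; rewrite ?sqrrN 1?addrC ?cos2Dsin2// addrC cos2Dsin2.
  - by ring.
  - move=> x y; rewrite (le_trans (FL _ _))// ler_wpM2r//.
  - by lra.
rewrite lee_pdivrMr// => H.
have sub : dot t @` flat_part `<=` good_set E eps w1 w2 F (c - rho) (c + rho).
  move=> _ [x Gx <-]; split.
    by have := Xc _ Gx.1; rewrite ler_distl.
  exists (perp t x - F (dot t x)).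
    by have := FG _ Gx; rewrite ler_norml.
  by rewrite /w1 /w2 /= subrKC -(coord_dot_perp t x); exact: XE Gx.1.
apply: (le_trans (lebesgue_measure_le sub)); apply: (le_trans H).
by rewrite -EFinM lee_fin; lra.
Qed.

(** [greedy_density] with a radius depending on the point: [s * h / 10], where [h] is the supremum
    of the [perp] separations of the steep partners of [x]. Since [eps <= h <= 2 * rho], the radii
    lie between [s * eps / 10] and [s * rho / 5]. *)
Lemma steep_part_density (c rho kap : R) :
  0 < s -> 0 < eps -> 0 <= kap ->
  (forall x, X x -> `|dot t x - c| <= rho) ->
  (forall x y, X x -> X y -> `|perp t y - perp t x| <= 2 * rho) ->
  (forall x y h, X x -> X y -> eps <= h -> h <= 2 * rho ->
     `|dot t y - dot t x| <= s * `|perp t y - perp t x| ->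
     h / 2 <= `|perp t y - perp t x| -> `|perp t y - perp t x| <= h ->
     (forall z, X z -> `|dot t z - dot t x| <= s * h / 10 ->
        `|perp t z - perp t x| <= h) ->
     (lebesgue_measure (dot t @` X `&` [set u | (`|u - dot t x| <= s * h / 10)%R])
        <= (kap * (s * h / 10))%:E)%E) ->
  (lebesgue_measure (dot t @` (X `\` flat_part)) <= (kap * (Num.max 0 (2 * rho + s * rho)))%:E)%E.
Proof.
move=> s0 eps0 kap0 Xc Xw dens.
pose P := dot t @` (X `\` flat_part).
have := @greedy_density R P (c - rho) (c + rho) (s * eps / 10) (s * rho / 5) kap.
move=> /(_ _ kap0) H; apply: (le_trans (H _ _ _)).
- by rewrite divr_gt0// mulr_gt0.
- by move=> _ [x [Xx _] <-]; have := Xc _ Xx; rewrite ler_distl.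
- move=> _ [x [Xx nGx] <-].
  have [y Xy sxy] : exists2 y, X y & steep x y.
    apply: contrapT => ne; apply: nGx; split => // y Xy sy; apply: ne.
    by exists y.
  pose W := [set `|perp t y - perp t x| | y in [set y | X y /\ steep x y]].
  have hW : has_sup W.
    split; first by exists (`|perp t y - perp t x|); exists y.
    by exists (2 * rho) => _ [z [Xz _] <-]; exact: Xw.
  pose h := sup W.
  have Wle z : X z -> steep x z -> `|perp t z - perp t x| <= h.
    by move=> Xz sz; apply: ub_le_sup; [exact: hW.2|exists z].
  have eh : eps <= h by apply: le_trans (Wle y Xy sxy); exact: sxy.2.
  have h0 : 0 < h by apply: lt_le_trans eh.
  have hr : h <= 2 * rho.
    by apply: ge_sup; [exact: hW.1|move=> _ [z [Xz _] <-]; exact: Xw].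
  have [_ [z [Xz sz] <-] zh] := sup_adherent (divr_gt0 h0 (ltr0n R 2)) hW.
  exists (s * h / 10); split.
    apply/andP; split; first by rewrite ler_pM2r// ler_pM2l.
    rewrite -!mulrA ler_pM2l//; lra.
  apply: (@le_trans _ _ (lebesgue_measure (dot t @` X `&` [set u | (`|u - dot t x| <= s * h / 10)%R]))).
    by apply: lebesgue_measure_le => _ [[v [Xv _] <-] vx]; split => //.
  apply: (dens x z h) => //; first exact: sz.1.
  - by rewrite -/h in zh; lra.
  - exact: Wle.
  (* A point of the narrow strip farther than [h] would itself be a steep partner of [x], against
     the choice of [h] as a supremum. *)
  move=> v Xv vx; rewrite leNgt; apply/negP => hv.
  have : `|perp t v - perp t x| <= h; last by rewrite leNgt hv.
  apply: Wle => //; split; last by rewrite (le_trans eh)// ltW.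
  by rewrite (le_trans vx)// -mulrA ler_pM2l//; lra.
rewrite lee_fin ler_wpM2l// ge_max !le_max lexx /=.
have [rho0|rho0] := leP rho 0; apply/orP; [left|right].
  have : s * rho <= 0 by rewrite pmulr_rle0.
  lra.
have : 0 < s * rho by rewrite mulr_gt0.
lra.
Qed.

End SteepPairs.

(** * The projection of the part of [E] in one ball of a covering *)

Section BallPiece.
Variables (R : realType) (I : finType) (z : I -> R * R) (rad : I -> R).

Definition in_sector (t s lo hi r : R) (i j : I) :=
  [&& lo <= dist1 (z i) (z j) <= hi,
      `|dot t (z j) - dot t (z i)| <= s * `|perp t (z j) - perp t (z i)| &
      dist1 (z i) (z j) <= r].

(** Passage from points to centres of the tiny balls. The errors are multiples of
    [rho <= s * eps / 40], which the slack between the slopes [44 / 10 * s] and [6 * s] and between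
    the radii absorbs. *)
Lemma in_sector_of_points (t s eps rho RB h : R) (i j : I) (x v : R * R) :
  0 < s <= 1 -> 0 < eps -> 0 <= rho <= RB -> eps <= h -> 40 * rho <= s * eps ->
  0 <= rad i <= rho -> 0 <= rad j <= rho ->
  eball (z i) (rad i) x -> eball (z j) (rad j) v ->
  dist1 x v <= 4 * RB -> h / 4 <= `|perp t v - perp t x| <= 2 * h ->
  `|dot t v - dot t x| <= 11 / 10 * s * h ->
  `|dot t v - dot t x| <= 44 / 10 * s * `|perp t v - perp t x| ->
  in_sector t (6 * s) (eps / 10) (8 * RB) (8 * h) i j.
Proof.
move=> /andP[s0 s1] eps0 /andP[rho0 rhoRB] eh rs /andP[ri0 ri] /andP[rj0 rj] xi vj xvB
  /andP[w1 w2] u1 u2.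
have rho_eps : 40 * rho <= eps by rewrite (le_trans rs)// ger_pMl.
have seh : s * eps <= s * h by rewrite ler_pM2l.
have dx := eball_dist1 ri0 xi; have dv := eball_dist1 rj0 vj.
have xv := dist1_le_dot_perp t x v.
have t1 := dist1_triangle x (z i) (z j); have t2 := dist1_triangle v x (z j).
rewrite (dist1C (z i) x) in t1.
have px := eball_perp t ri0 xi; have pv := eball_perp t rj0 vj.
have qx := eball_dot t ri0 xi; have qv := eball_dot t rj0 vj.
have pD := perp_le_dist1 t (z i) (z j).
set w := `|perp t v - perp t x| in w1 w2 u2 *.
set W := `|perp t (z j) - perp t (z i)|.
have Ww : w - 2 * rho <= W.
  have := ler_normD (perp t v - perp t (z j)) ((perp t (z j) - perp t (z i)) - (perp t x - perp t (z i))).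
  have := ler_normB (perp t (z j) - perp t (z i)) (perp t x - perp t (z i)).
  rewrite (_ : perp t v - perp t (z j) + _ = perp t v - perp t x); last by ring.
  by rewrite -/w -/W; lra.
have Uu : `|dot t (z j) - dot t (z i)| <= `|dot t v - dot t x| + 2 * rho.
  have := ler_normD (dot t v - dot t x) ((dot t x - dot t (z i)) - (dot t v - dot t (z j))).
  have := ler_normB (dot t x - dot t (z i)) (dot t v - dot t (z j)).
  rewrite (_ : dot t v - dot t x + _ = dot t (z j) - dot t (z i)); last by ring.
  lra.
rewrite distrC -/W in pD; rewrite (distrC (dot t x)) (distrC (perp t x)) -/w in xv.
have sh : s * h <= h by rewrite ler_piMl//; lra.
rewrite /in_sector; apply/and3P; split.
- apply/andP; split; lra.
- rewrite (le_trans Uu)//.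
  have : 6 * s * (w - 2 * rho) <= 6 * s * W by rewrite ler_wpM2l//; lra.
  have : s * (h / 4) <= s * w by rewrite ler_pM2l.
  have : s * rho <= rho by rewrite ler_piMl.
  rewrite -/W; lra.
- lra.
Qed.

(** Since [x] and [y] are at least [h / 2] apart in the [perp] coordinate, every point of the strip
    is at least [h / 4] away from one of them. It is therefore seen in the sector of [x] or in that
    of [y], and the sector bound [G * (8 * h)] is used twice. *)
Lemma strip_density (t s eps rho RB G : R) (X : set (R * R)) (Nm : pred I) :
  0 < s <= 1 -> 0 < eps -> 0 <= rho <= RB -> 40 * rho <= s * eps ->
  (forall i, 0 <= rad i <= rho) ->
  (forall x, X x -> exists2 i, Nm i & eball (z i) (rad i) x) ->
  (forall x y, X x -> X y -> dist1 x y <= 4 * RB) ->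
  (forall i r, Nm i -> eps <= r ->
    \sum_(j | in_sector t (6 * s) (eps / 10) (8 * RB) r i j) 2 * rad j <= G * r) ->
  forall x y h, X x -> X y -> eps <= h ->
     `|dot t y - dot t x| <= s * `|perp t y - perp t x| ->
     h / 2 <= `|perp t y - perp t x| -> `|perp t y - perp t x| <= h ->
     (forall v, X v -> `|dot t v - dot t x| <= s * h / 10 ->
        `|perp t v - perp t x| <= h) ->
     (lebesgue_measure (dot t @` X `&` [set u | (`|u - dot t x| <= s * h / 10)%R])
        <= (160 * G / s * (s * h / 10))%:E)%E.
Proof.
move=> s01 eps0 rho01 rs radP Xcov XB low x y h Xx Xy eh sxy hxy1 hxy2 hv.
have [s0 s1] := andP s01.
have [i Ni xi] := Xcov _ Xx; have [i' Ni' yi'] := Xcov _ Xy.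
pose A k := [set u | exists2 j, in_sector t (6 * s) (eps / 10) (8 * RB) (8 * h) k j &
                `|u - dot t (z j)| <= rad j].
have h0 : 0 < h by apply: lt_le_trans eh.
have AG k : Nm k -> (lebesgue_measure (A k) <= (G * (8 * h))%:E)%E.
  move=> Nk; apply: (@le_trans _ _ (\sum_(j | in_sector t (6 * s) (eps / 10) (8 * RB) (8 * h) k j) (2 * rad j)%:E)%E); last first.
    by rewrite sumEFin lee_fin low//; lra.
  pose F j := [set u | `|u - dot t (z j)| <= rad j].
  apply: (le_trans (@lebesgue_measure_cover _ _ (in_sector t (6 * s) (eps / 10) (8 * RB) (8 * h) k) F _ _)).
    by move=> u [j Pj uj]; exists j.
  apply: lee_sum => j _; apply: (@lebesgue_measure_interval_le _ (dot t (z j))) => //.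
  by have /andP[] := radP j.
have sub : dot t @` X `&` [set u | (`|u - dot t x| <= s * h / 10)%R] `<=` A i `|` A i'.
  move=> _ [[v Xv <-] /= vx].
  have [j Nj vj] := Xcov _ Xv.
  have vj' : `|dot t v - dot t (z j)| <= rad j.
    by apply/ltW/eball_dot => //; have /andP[] := radP j.
  have wv := hv _ Xv vx.
  have sh : 0 < s * h by rewrite mulr_gt0.
  have [w4|w4] := leP (h / 4) `|perp t v - perp t x|.
    left; exists j => //.
    apply: (in_sector_of_points (rho := rho) (x := x) (v := v)) => //.
    - exact: XB.
    - by rewrite w4 /=; lra.
    - lra.
    - have : s * (h / 4) <= s * `|perp t v - perp t x| by rewrite ler_pM2l.
      lra.
  right; exists j => //.
  have tri := ler_distD (perp t v) (perp t y) (perp t x).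
  have tri2 := ler_distD (perp t x) (perp t v) (perp t y).
  have tri3 := ler_distD (dot t x) (dot t v) (dot t y).
  (* Seen from [y], the [dot] difference is at most [s * h / 10 + s * h]; divided by [h / 4] this is
     the slope [44 / 10 * s]. *)
  rewrite (distrC (dot t x)) in tri3; rewrite (distrC (perp t x)) in tri2.
  rewrite (distrC (perp t y) (perp t v)) in tri.
  have w5 : h / 4 <= `|perp t v - perp t y| by lra.
  have sw : s * `|perp t y - perp t x| <= s * h by rewrite ler_pM2l.
  apply: (in_sector_of_points (rho := rho) (x := y) (v := v)) => //.
  - exact: XB.
  - by rewrite w5 /=; lra.
  - lra.
  - have : s * (h / 4) <= s * `|perp t v - perp t y| by rewrite ler_pM2l.
    lra.
apply: (le_trans (lebesgue_measure_le sub)).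
apply: (le_trans (lebesgue_measureU_le _ _)).
apply: (le_trans (leeD (AG i Ni) (AG i' Ni'))).
rewrite -EFinD lee_fin (_ : 160 * G / s * (s * h / 10) = 16 * G * h); first lra.
by field; rewrite gt_eqF.
Qed.

(** The flat part is bounded by the rectifiability constant and contributes [2 * kap * RB]. The
    steep part contributes [160 * G / s] times [2 * RB + s * RB], which is at most [3 * RB]. *)
Lemma ball_piece_bound (E : set (R * R)) (t s eps rho RB G r M kap : R)
    (X : set (R * R)) (Nm : pred I) (c : R * R) :
  0 < s <= 1 -> 0 < eps -> 0 <= rho <= RB -> 0 < RB -> 40 * rho <= s * eps -> 0 <= G ->
  (forall i, 0 <= rad i <= rho) ->
  (forall x, X x -> exists2 i, Nm i & eball (z i) (rad i) x) ->
  X `<=` eball c RB -> X `<=` E ->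
  (rect_const E eps r M <= kap%:E)%E -> s^-1 <= M -> r <= RB ->
  (forall i r, Nm i -> eps <= r ->
    \sum_(j | in_sector t (6 * s) (eps / 10) (8 * RB) r i j) 2 * rad j <= G * r) ->
  (lebesgue_measure (dot t @` X) <= ((2 * kap + 480 * G / s) * RB)%:E)%E.
Proof.
move=> s01 eps0 rho01 RB0 rs G0 radP Xcov Xc XE RE sM rRB low.
have [s0 s1] := andP s01.
have Xdot x : X x -> `|dot t x - dot t c| <= RB.
  by move=> /Xc/(eball_dot t (ltW RB0))/ltW.
have Xperp x : X x -> `|perp t x - perp t c| <= RB.
  by move=> /Xc/(eball_perp t (ltW RB0))/ltW.
have Gs : 0 <= 160 * G / s by rewrite divr_ge0 ?mulr_ge0// ltW.
have RB2 : r <= 2 * RB by lra.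
have Xlow x : X x -> perp t c - RB <= perp t x.
  by move=> /Xperp; rewrite ler_distl => /andP[].
have good := rect_const_flat_part s0 eps0 RE sM XE RB0 RB2 Xdot Xlow.
have Xosc x y : X x -> X y -> `|perp t y - perp t x| <= 2 * RB.
  move=> /Xperp xc /Xperp yc.
  by have := ler_distD (perp t c) (perp t y) (perp t x); rewrite (distrC (perp t c)); lra.
have bad := steep_part_density s0 eps0 Gs Xdot Xosc.
have sub : dot t @` X `<=` dot t @` flat_part t s eps X `|` dot t @` (X `\` flat_part t s eps X).
  move=> _ [x Xx <-]; have [Gx|Gx] := pselect (flat_part t s eps X x).
    by left; exists x.
  by right; exists x.
have XB x y : X x -> X y -> dist1 x y <= 4 * RB.
  move=> /Xc vc /Xc wc; have := dist1_triangle c x y; rewrite (dist1C c).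
  have := eball_dist1 (ltW RB0) vc; have := eball_dist1 (ltW RB0) wc.
  lra.
apply: (le_trans (lebesgue_measure_le sub)).
apply: (le_trans (lebesgue_measureU_le _ _)).
apply: (le_trans (leeD good (bad _))).
  move=> x y h Xx Xy eh _.
  exact: (strip_density s01 eps0 rho01 rs radP Xcov XB low Xx Xy eh).
rewrite -EFinD lee_fin (max_idPr _); last by rewrite addr_ge0 ?mulr_ge0// ltW.
have : 160 * G / s * (s * RB) <= 160 * G / s * RB.
  by rewrite ler_wpM2l// ger_pMl.
lra.
Qed.

End BallPiece.

(** * The angular grid and the mass of a sector *)

Lemma sum_subpredU (R : realType) (I : finType) (P P1 P2 : pred I) (f : I -> R) :
  (forall i, 0 <= f i) -> (forall i, P i -> P1 i || P2 i) ->
  \sum_(i | P i) f i <= \sum_(i | P1 i) f i + \sum_(i | P2 i) f i.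
Proof.
move=> f0 PP; rewrite big_mkcond [X in _ <= X + _]big_mkcond.
rewrite [X in _ <= _ + X]big_mkcond -big_split /=; apply: ler_sum => i _.
have := PP i; have := f0 i.
case: (P i) (P1 i) (P2 i) => [] [] [] /= f0' H; by [lra | have := H isT].
Qed.

Lemma sum_subpred (R : realType) (I : finType) (P Q : pred I) (f : I -> R) :
  (forall i, 0 <= f i) -> (forall i, P i -> Q i) ->
  \sum_(i | P i) f i <= \sum_(i | Q i) f i.
Proof.
move=> f0 PQ; rewrite big_mkcond [leRHS]big_mkcond; apply: ler_sum => i _.
by have := PQ i; case: (P i) => [/(_ isT) ->//|_]; case: ifP.
Qed.

Lemma adjacent_succ c : adjacent c c.+1.
Proof. by rewrite /adjacent; lia. Qed.

Lemma adjacent_pred c : adjacent c c.-1.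
Proof. by rewrite /adjacent; lia. Qed.

Section AngularGrid.
Variable R : realType.

(* Level [k] splits the angular range [-1, 15] into [2 ^ k] cells; it contains
   [0, 2 * pi] with room for the neighbours of every cell that is used. *)
Definition gridw (k : nat) : R := 16 / 2 ^+ k.
Definition gridpt (k c : nat) : R := -1 + c%:R * gridw k.

Lemma gridw_gt0 k : 0 < gridw k.
Proof. by rewrite divr_gt0// exprn_gt0. Qed.

Lemma gridwS k : gridw k = 2 * gridw k.+1.
Proof. by rewrite /gridw exprS; field; rewrite expf_neq0. Qed.

Lemma gridw_leq n k : (k <= n)%N -> gridw k = (2 ^ (n - k))%N%:R * gridw n.
Proof.
move=> kn; rewrite /gridw natrX -{2}(subnKC kn) exprD.
by field; rewrite !expf_neq0.
Qed.

Lemma gridptS k c : gridpt k c.+1 = gridpt k c + gridw k.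
Proof. by rewrite /gridpt -natr1; ring. Qed.

Lemma gridpt_half k c : gridpt k.+1 c.*2 = gridpt k c.
Proof. by rewrite /gridpt (gridwS k) -mul2n natrM; ring. Qed.

Lemma gridpt_cell n k a : (k <= n)%N ->
  gridpt k (cell n k a) <= gridpt n a /\ gridpt n a.+1 <= gridpt k (cell n k a).+1.
Proof.
move=> kn; have w0 := gridw_gt0 n.
rewrite /gridpt (gridw_leq kn) !lerD2l !mulrA !ler_pM2r// -!natrM !ler_nat.
split; first exact: leq_divM.
by rewrite -ltn_divLR ?expn_gt0// ltnS.
Qed.

Lemma near_angle n k c (S : {set 'I_(2 ^ n)}) : (k <= n)%N -> near S k c ->
  exists2 a : 'I_(2 ^ n), a \in S & forall phi : R,
    gridpt k c <= phi <= gridpt k c.+1 -> `|gridpt n a - phi| <= 2 * gridw k.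
Proof.
move=> kn /existsP[a /andP[aS /andP[h1 h2]]]; exists a => // phi /andP[p1 p2].
have [q1 q2] := gridpt_cell a kn.
have w0 := gridw_gt0 k; have w0' := gridw_gt0 n.
have m (d e : nat) : (d <= e)%N -> gridpt k d <= gridpt k e.
  by move=> de; rewrite lerD2l ler_pM2r// ler_nat.
have := m _ _ h1; have := m _ _ h2; rewrite !gridptS in p2 q2 *.
by move=> m1 m2; rewrite ler_distl; apply/andP; split; lra.
Qed.

Section SectorDensity.
Variables (I : finType) (z : I -> R * R) (rad : I -> R) (i : I).
Variables (n k0 k1 : nat) (S : {set 'I_(2 ^ n)}) (A rho lo hi r : R).

Definition far_from j := lo <= dist1 (z i) (z j) <= hi.

Definition hit c :=
  [exists j, far_from j && cone (gridpt k1 c) (gridpt k1 c.+1) (z i) (z j)].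

Let g k c : R := \sum_(j | [&& far_from j, cone (gridpt k c) (gridpt k c.+1) (z i) (z j)
                          & dist1 (z i) (z j) <= r]) 2 * rad j.

Hypothesis rad0 : forall j, 0 <= rad j.
Hypothesis A0 : 0 <= A.
Hypothesis r0 : 0 < r.
Hypothesis k1n : (k1 <= n)%N.
Hypothesis k01 : (k0 <= k1)%N.
Hypothesis rho_small : rho <= 2 * r * gridw k1.
Hypothesis light : forall a w, a \in S -> rho <= w ->
  \sum_(j | `|dot (gridpt n a) (z j) - dot (gridpt n a) (z i)| <= w) 2 * rad j <= A * w.

Let B := A * (2 * r * gridw n).
Let T := sparse_leaves S k0 k1 hit.

Let rad2 j : 0 <= 2 * rad j. Proof. by rewrite mulr_ge0. Qed.

Lemma gridw_anti k k' : (k <= k')%N -> gridw k' <= gridw k.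
Proof.
move=> kk; rewrite (gridw_leq kk) ler_peMl ?ler1n ?expn_gt0//.
exact/ltW/gridw_gt0.
Qed.

(** All angles of a near cell are within [2 * gridw k] of a direction of [S], so the truncated cone
    lies in a strip that is not over-full. Allowing any two angles of the cell makes the bound apply
    to the children of a near cell as well. *)
Lemma cone_sum_le k c s1 s2 : (k <= k1)%N -> near S k c ->
  gridpt k c <= s1 <= gridpt k c.+1 -> gridpt k c <= s2 <= gridpt k c.+1 ->
  \sum_(j | [&& far_from j, cone s1 s2 (z i) (z j) & dist1 (z i) (z j) <= r]) 2 * rad j
    <= B * (2 ^ (n - k))%N%:R.
Proof.
move=> kk nc hs1 hs2; have kn := leq_trans kk k1n.
have [a aS Ha] := near_angle kn nc.
have := Ha _ hs1; have := Ha _ hs2 => h2 h1.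
have -> : B * (2 ^ (n - k))%N%:R = A * (2 * r * gridw k).
  by rewrite /B (gridw_leq kn); ring.
have r0' := r0.
apply: le_trans (@light a (2 * r * gridw k) aS _); last first.
  by rewrite (le_trans rho_small)// ler_pM2l ?gridw_anti// mulr_gt0.
apply: sum_subpred => // j /and3P[_ cj dj].
rewrite (le_trans (cone_dot_le cj h1 h2))//.
have w0 := gridw_gt0 k.
have : dist1 (z i) (z j) * (2 * gridw k) <= r * (2 * gridw k).
  by rewrite ler_wpM2r// mulr_ge0// ltW.
lra.
Qed.

(** [dyadic_bound] for the mass of the cone over a cell. A near cell at level [k1] that is not hit
    has an empty cone. *)
Lemma cone_cell_bound c : (c < 2 ^ k0)%N -> near S k0 c ->
  g k0 c <= 2 * B * (#|T :&: cell_set n k0 c|%SET)%:R.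
Proof.
move=> ck nc; apply: (@dyadic_bound n R g B S k0 k1 hit) => //.
- by rewrite /B !mulr_ge0// ltW// gridw_gt0.
- move=> k e /andP[_ kk]; apply: sum_subpredU => // j /and3P[fj cj dj].
  rewrite fj dj /= !andbT gridpt_half -[gridpt k.+1 e.*2.+2]/(gridpt k.+1 e.+1.*2) gridpt_half.
  by apply/orP; exact: cone_split.
- move=> k e /andP[_ kk] ne; apply: (@cone_sum_le k e) => //.
    by rewrite lexx /= gridptS lerDl ltW ?gridw_gt0.
  by rewrite lexx andbT gridptS lerDl ltW ?gridw_gt0.
- move=> k e /andP[_ kk] ne; apply: (@cone_sum_le k e./2) => //; first exact: ltnW.
    rewrite -!(gridpt_half k) /gridpt !lerD2l !ler_pM2r ?gridw_gt0// !ler_nat.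
    by lia.
  rewrite -!(gridpt_half k) /gridpt !lerD2l !ler_pM2r ?gridw_gt0// !ler_nat.
  by lia.
- move=> e _ /existsPn he; rewrite /g big_pred0// => j.
  by have := he j; rewrite negb_and /far_from; case: (_ <= _ <= _) => //= /negbTE ->.
Qed.

(** A sector of slope at most [gridw k0 / 2] around [t] lies in the cones over the cell of [a] and
    its two neighbours, all three near [S]. Their total mass is controlled by the leaves of [T]
    there, at most a proportion [eta]. *)
Lemma sector_density (a : 'I_(2 ^ n)) (t s eta : R) :
  a \in S -> gridpt n a <= t <= gridpt n a.+1 ->
  (0 < cell n k0 a)%N -> ((cell n k0 a).+1 < 2 ^ k0)%N ->
  gridw k0 <= 1 / 4 -> s <= gridw k0 / 2 ->
  (#|[set b in T | adjacent (cell n k0 b) (cell n k0 a)]%SET|)%:R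
      <= eta * (2 ^ (n - k0))%N%:R ->
  \sum_(j | in_sector z t s lo hi r i j) 2 * rad j <= 4 * A * eta * gridw k0 * r.
Proof.
move=> aS /andP[t1 t2] c0 c1 w4 sw Teta.
have k0n := leq_trans k01 k1n.
have [q1 q2] := gridpt_cell a k0n.
have w0 := gridw_gt0 k0; have w0n := gridw_gt0 n.
set c := cell n k0 a in c0 c1 q1 q2 Teta *.
have n1 : near S k0 c.-1.
  by apply/existsP; exists a; rewrite aS -/c adjacent_pred.
have n2 : near S k0 c by exact: mem_near.
have n3 : near S k0 c.+1.
  by apply/existsP; exists a; rewrite aS -/c adjacent_succ.
have c2 : (c < 2 ^ k0)%N by exact: ltnW.
have b1 := @cone_cell_bound c.-1 (leq_ltn_trans (leq_pred _) c2) n1.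
have b2 := @cone_cell_bound c c2 n2.
have b3 := @cone_cell_bound c.+1 c1 n3.
have e1 : gridpt k0 c = gridpt k0 c.-1 + gridw k0.
  by rewrite -gridptS prednK.
have e2 := gridptS k0 c; have e3 := gridptS k0 c.+1.
have sub j : in_sector z t s lo hi r i j ->
   [&& far_from j, cone (gridpt k0 c.-1) (gridpt k0 c.-1.+1) (z i) (z j)
                          & dist1 (z i) (z j) <= r] ||
   ([&& far_from j, cone (gridpt k0 c) (gridpt k0 c.+1) (z i) (z j)
                          & dist1 (z i) (z j) <= r] ||
   [&& far_from j, cone (gridpt k0 c.+1) (gridpt k0 c.+2) (z i) (z j)
                          & dist1 (z i) (z j) <= r]).
  rewrite /in_sector => /and3P[fj sj dj].
  rewrite /far_from fj dj /= !andbT prednK//.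
  have := @cone_of_slope R t (t - gridpt k0 c.-1) (gridpt k0 c.+2 - t) (gridw k0) (z i) (z j).
  rewrite subKr subrKC => H.
  have /(cone_split (gridpt k0 c)) : cone (gridpt k0 c.-1) (gridpt k0 c.+2) (z i) (z j).
    apply: H; first (apply/andP; split; lra).
    - lra.
    - apply/andP; split; lra.
    - by rewrite (le_trans sj)// ler_wpM2r.
  move=> [->//|/(cone_split (gridpt k0 c.+1)) [->|->]]; by rewrite ?orbT.
apply: (le_trans (@sum_subpredU _ _ _ _ _ (fun j => 2 * rad j) rad2 sub)).
apply: (le_trans (lerD (lexx _) (@sum_subpredU _ _ _ _ _ (fun j => 2 * rad j) rad2 (fun j h => h)))).
rewrite -/(g k0 c.-1) -/(g k0 c) -/(g k0 c.+1).
have B0 : 0 <= 2 * B by rewrite /B !mulr_ge0// ltW.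
apply: (@le_trans _ _ (2 * B * (eta * (2 ^ (n - k0))%N%:R))); last first.
  rewrite /B (gridw_leq k0n); lra.
apply: (@le_trans _ _ (2 * B * (#|[set b in T | adjacent (cell n k0 b) c]%SET|)%:R)); last first.
  by rewrite ler_wpM2l.
apply: (@le_trans _ _ (2 * B * (#|T :&: cell_set n k0 c.-1| + (#|T :&: cell_set n k0 c| +
   #|T :&: cell_set n k0 c.+1|))%SET%N%:R)).
  by rewrite !natrD !mulrDr lerD ?lerD.
by rewrite ler_wpM2l// ler_nat card_three_cells.
Qed.

End SectorDensity.
End AngularGrid.

(** * Pigeonhole over coarse and inner scales *)

Lemma sum_bool_drops (x : nat -> bool) q :
  (forall b, (b < q)%N -> x b.+1 -> x b) ->
  (\sum_(b < q) (x b && ~~ x b.+1) + x q <= 1)%N.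
Proof.
elim: q => [|q IH] xdec; first by rewrite big_ord0 leq_b1.
rewrite big_ord_recr /=; have := IH (fun b h => xdec b (ltnW h)).
by have := xdec q (ltnSn q); case: (x q) (x q.+1) => [] [] //= H; rewrite ?addn0 ?addn1 //; have := H isT.
Qed.

Section Pigeonhole.
Variables (R : realType) (I : finType) (wt : I -> R) (n : nat) (k : nat -> nat).
Variables (Q D K : nat) (S : I -> {set 'I_(2 ^ n)}) (hitp : nat -> nat -> I -> pred nat).

(** Two averagings. The fattenings decrease, so a leaf drops out at most once over all [b], and some
    [b] loses at most the fraction [1 / Q]. For this [b], a leaf that stays is hit for at most [K]
    of the [D] values of [l], and some [l] has at most the fraction [K / D]. *)
Lemma exists_sparse_scale :
  (forall i, 0 <= wt i) -> (0 < Q)%N -> (0 < D)%N ->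
  (forall b, (b < Q)%N -> (k b <= k b.+1 <= n)%N) ->
  (forall (i : I) (a : 'I_(2 ^ n)) b, (b < Q)%N -> near (S i) (k b.+1) (cell n (k b.+1) a) ->
    (#|[set l : 'I_D | hitp b l i (cell n (k b.+1) a)]%SET| <= K)%N) ->
  exists b l, [/\ (b < Q)%N, (l < D)%N &
    \sum_i wt i * (#|sparse_leaves (S i) (k b) (k b.+1) (hitp b l i)|)%:R
      <= (\sum_i wt i) * (2 ^ n)%N%:R * (1 / Q%:R + K%:R / D%:R)].
Proof.
move=> wt0 Q0 D0 kmon mult.
set X := (\sum_i wt i) * (2 ^ n)%N%:R.
pose drop (b : nat) i := [set a : 'I_(2 ^ n) | near (S i) (k b) (cell n (k b) a) &&
   ~~ near (S i) (k b.+1) (cell n (k b.+1) a)]%SET.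
pose kept (b l : nat) i := [set a : 'I_(2 ^ n) | near (S i) (k b.+1) (cell n (k b.+1) a) &&
   hitp b l i (cell n (k b.+1) a)]%SET.
have cE (V : finType) (Y : {set V}) : #|Y| = (\sum_b (b \in Y))%N.
  by rewrite -sum1_card big_mkcond; apply: eq_bigr => b _; case: (b \in Y).
have dropX : \sum_(b < Q) \sum_i wt i * (#|drop b i|)%:R <= X.
  rewrite exchange_big /X mulr_suml /=; apply: ler_sum => i _.
  rewrite -mulr_sumr ler_wpM2l// -natr_sum ler_nat.
  under eq_bigr do rewrite cE.
  rewrite exchange_big /= -[leqRHS]card_ord -sum1_card; apply: leq_sum => a _.
  pose x b := near (S i) (k b) (cell n (k b) a).
  have xdec b : (b < Q)%N -> x b.+1 -> x b.
    by move=> bQ; apply: near_cell_anti; exact: kmon.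
  apply: leq_trans (sum_bool_drops xdec); rewrite -[leqLHS]addn0 leq_add//.
  by apply: leq_sum => b _; rewrite finset.in_set.
have [b Hb] := exists_le_average Q0 dropX.
have keptX : \sum_(l < D) \sum_i wt i * (#|kept b l i|)%:R <= X * K%:R.
  rewrite exchange_big /X 2!mulr_suml /=; apply: ler_sum => i _.
  rewrite -mulr_sumr -mulrA ler_wpM2l// -natr_sum -natrM ler_nat.
  under eq_bigr do rewrite cE.
  rewrite exchange_big /= -[X in (_ <= X * _)%N]card_ord -sum1_card big_distrl /=.
  apply: leq_sum => a _; rewrite mul1n.
  have [na|na] := boolP (near (S i) (k b.+1) (cell n (k b.+1) a)).
    apply: leq_trans (mult i a b (ltn_ord b) na); rewrite cE.
    by apply: leq_sum => l _; rewrite !finset.in_set na.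
  by rewrite big1// => l _; rewrite finset.in_set (negbTE na).
have [l Hl] := exists_le_average D0 keptX.
exists b, l; split => //.
apply: (@le_trans _ _ (\sum_i wt i * (#|drop b i|)%:R + \sum_i wt i * (#|kept b l i|)%:R)).
  rewrite -big_split /=; apply: ler_sum => i _; rewrite -mulrDr ler_wpM2l//.
  rewrite -natrD ler_nat (leq_trans _ (leq_card_setU _ _))//.
  apply: subset_leq_card; apply/fintype.subsetP => a.
  by rewrite finset.in_setU !finset.in_set.
by move: Hb Hl; rewrite -mulrA mulrDr div1r; lra.
Qed.

End Pigeonhole.

Lemma exceptional_weight (R : realType) (I : finType) (wt : I -> R) (n k : nat)
    (S T : I -> {set 'I_(2 ^ n)}) (eta X : R) : 0 < eta -> (forall i, 0 <= wt i) ->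
  \sum_i wt i * (#|T i|)%:R <= X ->
  \sum_(a < 2 ^ n) \sum_(i | a \in [set a in S i | (eta * (2 ^ (n - k))%N%:R <
     (#|[set b in T i | adjacent (cell n k b) (cell n k a)]|)%:R)%R]%SET) wt i
   <= 3 / eta * X.
Proof.
move=> eta0 wt0 TX.
under eq_bigr do rewrite big_mkcond.
rewrite exchange_big /=.
apply: (@le_trans _ _ (3 / eta * (\sum_i wt i * (#|T i|)%:R))); last first.
  by rewrite ler_wpM2l// divr_ge0// ltW.
rewrite mulr_sumr; apply: ler_sum => i _.
rewrite -big_mkcond /= sumr_const -[leLHS]mulr_natr mulrCA ler_wpM2l//.
exact: exceptional_card.
Qed.

(** * Over-full strips and lines meeting [E] at many scales *)

Section ExceptionalLines.
Variables (R : realType) (I : finType) (z : I -> R * R) (rad : I -> R) (rho : R).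

Lemma dot_change (t t' d w : R) (i j : I) :
  dist1 (z i) (z j) <= 8 -> `|t - t'| <= d -> `|dot t' (z j) - dot t' (z i)| <= w ->
  `|dot t (z j) - dot t (z i)| <= w + 8 * d.
Proof.
move=> d8 td hw; have := dot_angle_le t t' (z j) (z i); rewrite dist1C => h.
have : dist1 (z i) (z j) * `|t - t'| <= 8 * d by apply: ler_pM; rewrite ?dist1_ge0.
have := ler_normD (dot t (z j) - dot t (z i) - (dot t' (z j) - dot t' (z i)))
  (dot t' (z j) - dot t' (z i)).
by rewrite subrK; lra.
Qed.

(** Turning from the grid angle [t'] to [t] enlarges a strip of half-width [w] by at most
    [8 * d <= w]. Hence [vitali_density] is applied with widths [2 * w] and density [A / 2], which
    turns 12 into 24. *)
Lemma heavy_strips_bound (t t' A d : R) (P : pred I) (X : set R) :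
  0 < A -> 0 < rho -> 8 * d <= rho -> `|t - t'| <= d -> (forall i, 0 <= rad i <= rho) ->
  (forall i j, dist1 (z i) (z j) <= 8) ->
  (forall i, P i -> exists2 w, rho <= w &
     A * w < \sum_(j | `|dot t' (z j) - dot t' (z i)| <= w) 2 * rad j) ->
  (forall u, X u -> exists2 i, P i & `|u - dot t (z i)| <= rad i) ->
  (lebesgue_measure X <= (24 / A * \sum_i 2 * rad i)%:E)%E.
Proof.
move=> A0 rho0 d8 td radP dz heavy cov.
have /choice[w wP] : forall i, exists w, P i -> rho <= w /\
     A * w < \sum_(j | `|dot t' (z j) - dot t' (z i)| <= w) 2 * rad j.
  move=> i; have [Pi|Pi] := boolP (P i); last by exists 0.
  by have [w w1 w2] := heavy i Pi; exists w.
have rad2 j : 0 <= 2 * rad j by rewrite mulr_ge0//; have /andP[] := radP j.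
have -> : 24 / A = 12 / (A / 2) by field; rewrite gt_eqF.
have P2w i : P i -> w i + 8 * d <= 2 * w i by move=> /wP[]; lra.
apply: (@vitali_density _ _ P (fun i => dot t (z i)) (fun i => 2 * w i)) => //.
- by rewrite divr_gt0.
- by move=> i /wP[h _]; rewrite mulr_gt0// (lt_le_trans rho0).
- move=> i Pi; have [h1 h2] := wP i Pi.
  have -> : A / 2 * (2 * w i) = A * w i by field.
  apply: (le_trans (ltW h2)); apply: sum_subpred => // j hj.
  by rewrite (le_trans (dot_change (dz i j) td hj))// P2w.
- move=> u /cov[i Pi ui]; exists i => //; rewrite (le_trans ui)//.
  by have [h1 _] := wP i Pi; have /andP[_ h2] := radP i; lra.
Qed.

(** Each of the [K] scales supplies a centre close to the line, and a covering ball close to that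
    centre whose projection, enlarged 7 times, contains [u]. [markov_count] then gives the constant
    [2 * 7]. *)
Lemma multiplicity_bound (E : set (R * R)) (J : finType) (zc : J -> R * R) (rc : J -> R)
    (D K : nat) (lo hi : nat -> R) (t s Rm : R) (P : pred I) (X : set R) :
  (0 < K)%N -> 0 < s -> 2 * rho <= s -> (forall i, 0 <= rad i <= rho) ->
  (forall i, exists2 y, E y & eball (z i) (rad i) y) ->
  (forall j, s <= rc j <= Rm) ->
  (forall x, E x -> exists j, eball (zc j) (rc j) x) ->
  (forall l l', (l < l' < D)%N -> hi l' + 4 * Rm + 4 * rho < lo l) ->
  (forall i, P i -> (K <= #|[set l : 'I_D | [exists j, far_from z i (lo l) (hi l) j &&
      (`|dot t (z j) - dot t (z i)| <= 5 * s)%R]]%SET|)%N) ->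
  (forall u, X u -> exists2 i, P i & `|u - dot t (z i)| <= rad i) ->
  (lebesgue_measure X <= (14 / K%:R * \sum_j rc j)%:E)%E.
Proof.
move=> K0 s0 rhos radP meetE rcP Ecov sep PK cov.
have rc0 j : 0 <= 7 * rc j.
  by rewrite mulr_ge0// (le_trans (ltW s0))//; have /andP[] := rcP j.
apply: (@le_trans _ _ ((\sum_j 2 * (7 * rc j)) / K%:R)%:E); last first.
  rewrite lee_fin mulr_suml mulr_sumr; apply: ler_sum => j _; lra.
apply: le_trans (markov_count (fun j => dot t (zc j)) K0 rc0).
apply: lebesgue_measure_le => u /cov[i Pi ui] /=.
have := PK i Pi; set L := [set l : 'I_D | _]%SET => KL.
have wit (l : 'I_D) : l \in L -> exists j B, [/\ far_from z i (lo l) (hi l) j,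
    `|u - dot t (zc B)| <= 7 * rc B & dist1 (z j) (zc B) <= 2 * rc B + 2 * rho].
  rewrite finset.in_set => /existsP[j /andP[fj sj]].
  have [y Ey yj] := meetE j; have [B yB] := Ecov _ Ey.
  exists j, B; split => //.
    have /andP[rB1 rB2] := rcP B; have /andP[ri0 ri] := radP i; have /andP[rj0 rj] := radP j.
    have rB0 : 0 <= rc B by lra.
    have h1 := eball_dot t rj0 yj; have h2 := eball_dot t rB0 yB.
    move: ui sj h1 h2; rewrite !ler_distl !ltr_distl.
    by move=> /andP[a1 a2] /andP[b1 b2] /andP[c1 c2] /andP[d1 d2]; apply/andP; split; lra.
  have /andP[rB1 rB2] := rcP B; have /andP[rj0 rj] := radP j.
  have rB0 : 0 <= rc B by lra.
  have := dist1_triangle y (z j) (zc B); rewrite (dist1C (z j) y).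
  by have := eball_dist1 rj0 yj; have := eball_dist1 rB0 yB; lra.
have [l0 l0L] : exists l, l \in L.
  by apply/card_gt0P; apply: leq_trans KL.
have [_ [B0 _]] := wit l0 l0L.
have /choice[be beP] : forall l : 'I_D, exists B, l \in L -> exists j,
   [/\ far_from z i (lo l) (hi l) j,
    `|u - dot t (zc B)| <= 7 * rc B & dist1 (z j) (zc B) <= 2 * rc B + 2 * rho].
  move=> l; have [lL|lL] := boolP (l \in L); last by exists B0.
  by have [j [B H]] := wit l lL; exists B => _; exists j.
(* Different scales give different balls: two centres near one covering ball are at most
   [4 * Rm + 4 * rho] apart, less than the gap between the annuli. *)
have beI (l l' : 'I_D) : l \in L -> l' \in L -> (l < l')%N -> be l = be l' -> False.
  move=> lL l'L ll' bb; have := sep l l'; rewrite ll' ltn_ord => /(_ isT) sp.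
  have [j [fj _ dj]] := beP l lL; have [j' [fj' _ dj']] := beP l' l'L.
  have /andP[fj1 _] := fj; have /andP[_ fj2] := fj'.
  rewrite -bb in dj'.
  have := dist1_triangle (z j') (z i) (z j).
  have := dist1_triangle (zc (be l)) (z j') (z j); rewrite (dist1C (zc _) (z j)).
  by have /andP[_] := rcP (be l); lra.
have inj : {in L &, injective be}.
  move=> l l' lL l'L bb; apply: val_inj => /=.
  case: (ltngtP l l') => // h; exfalso.
    exact: (beI l l').
  by apply: (beI l' l).
apply: (leq_trans KL); rewrite -(card_in_imset inj); apply: subset_leq_card.
apply/fintype.subsetP => _ /imsetP[l lL ->]; rewrite inE.
by have [j []] := beP l lL.
Qed.

End ExceptionalLines.

(** * Typical and exceptional directions, and their projections *)

Section FixedDirection.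
Variables (R : realType) (E : set (R * R)) (L : R) (rm rp : nat -> R).
Variables (I : finType) (z : I -> R * R) (rad : I -> R) (rho : R).
Variables (n Q D K : nat) (A eta kap : R) (nb k : nat -> nat) (mm : nat -> nat -> nat).

(* [nb b] is the index of the [b]-th coarse scale and [mm b l] that of the
   [l]-th scale between the coarse scales [b] and [b + 1]. *)
Definition inner_radius b l := rp (mm b l).+1 / 10.
Definition outer_radius b l := 8 * rp (mm b l).

Definition crowded b (i : I) (a : nat) :=
  (K <= #|[set l : 'I_D | [exists j, far_from z i (inner_radius b l) (outer_radius b l) j &&
     (`|dot (gridpt R n a) (z j) - dot (gridpt R n a) (z i)| <= 4 * rm (nb b.+1))%R]]%SET|)%N.

Definition heavy (i : I) (a : nat) := `[< exists2 w, rho <= w &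
  A * w < \sum_(j | `|dot (gridpt R n a) (z j) - dot (gridpt R n a) (z i)| <= w) 2 * rad j >].

Definition typical i := [set a : 'I_(2 ^ n) | [forall b : 'I_Q, ~~ crowded b i a] && ~~ heavy i a]%SET.

Definition defect b l i :=
  sparse_leaves (typical i) (k b) (k b.+1) (hit z i (k b.+1) (inner_radius b l) (outer_radius b l)).

(** Typical directions around which the cone is not sparse enough for [sector_density]; they are few
    by [exceptional_card]. *)
Definition exceptional b l i := [set a in typical i | (eta * (2 ^ (n - k b))%N%:R <
     (#|[set c in defect b l i | adjacent (cell n (k b) c) (cell n (k b) a)]|)%:R)%R]%SET.

Hypothesis radP : forall i, 0 <= rad i <= rho.
Hypothesis meetE : forall i, exists2 y, E y & eball (z i) (rad i) y.
Hypothesis dz : forall i j, dist1 (z i) (z j) <= 8.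
Hypothesis sumL : \sum_i 2 * rad i <= 2 * L.
Hypothesis L0 : 0 < L.
Hypothesis A0 : 0 < A.
Hypothesis eta0 : 0 < eta.
Hypothesis kap0 : 0 <= kap.
Hypothesis rho0 : 0 < rho.
Hypothesis K0 : (0 < K)%N.
Hypothesis leaf : 8 * gridw R n <= rho.
Hypothesis kmon : forall b, (b < Q)%N -> (k b <= k b.+1 <= n)%N.

Lemma heavy_directions_bound (a : nat) (t : R) : gridpt R n a <= t <= gridpt R n a.+1 ->
  (lebesgue_measure [set u : R | exists2 i, heavy i a & (`|u - dot t (z i)| <= rad i)%R]
    <= (48 / A * L)%:E)%E.
Proof.
rewrite gridptS => /andP[t1 t2].
have ta : `|t - gridpt R n a| <= gridw R n by rewrite ler_distl; apply/andP; split; lra.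
apply: (le_trans (heavy_strips_bound (t := t) (P := heavy ^~ a) A0 rho0 leaf ta radP dz _ _)).
- by move=> i /asboolP.
- by move=> u.
rewrite lee_fin; have : 24 / A * \sum_i 2 * rad i <= 24 / A * (2 * L).
  by rewrite ler_wpM2l// divr_ge0// ltW.
by lra.
Qed.

Lemma crowded_directions_bound (b a : nat) (t : R) (J : finType) (zc : J -> R * R) (rc : J -> R) :
  gridpt R n a <= t <= gridpt R n a.+1 ->
  0 < rm (nb b.+1) -> 2 * rho <= rm (nb b.+1) ->
  (forall l l', (l < l' < D)%N -> outer_radius b l' + 4 * rp (nb b.+1) + 4 * rho < inner_radius b l) ->
  (forall j, rm (nb b.+1) <= rc j <= rp (nb b.+1)) ->
  (forall x, E x -> exists j, eball (zc j) (rc j) x) -> \sum_j rc j <= L ->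
  (lebesgue_measure [set u : R | exists2 i, crowded b i a & (`|u - dot t (z i)| <= rad i)%R]
    <= (14 / K%:R * L)%:E)%E.
Proof.
rewrite gridptS => /andP[t1 t2] s0 rhos sep rcP Ecov rcL.
have ta : `|t - gridpt R n a| <= gridw R n by rewrite ler_distl; apply/andP; split; lra.
have leaf' := leaf.
apply: (le_trans (multiplicity_bound (t := t) (P := fun i => crowded b i a) K0 s0 rhos radP meetE rcP Ecov sep _ _)).
- move=> i /leq_trans; apply; apply: subset_leq_card; apply/fintype.subsetP => l.
  rewrite !finset.in_set => /existsP[j /andP[fj hj]]; apply/existsP; exists j.
  rewrite fj /= (le_trans (dot_change (dz i j) ta hj))//; lra.
- by move=> u.
by rewrite lee_fin ler_wpM2l// divr_ge0.
Qed.

(** A cell near a typical direction [a'] has angles within [2 * gridw] of it. At distance at most 8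
    its cone stays within [16 * gridw <= 4 * rm (nb b.+1)] of the line of [a'], which is the
    tolerance in [crowded]. *)
Lemma typical_multiplicity b (i : I) (a : 'I_(2 ^ n)) : (b < Q)%N ->
  gridw R (k b.+1) <= rm (nb b.+1) / 4 ->
  near (typical i) (k b.+1) (cell n (k b.+1) a) ->
  (#|[set l : 'I_D | hit z i (k b.+1) (inner_radius b l) (outer_radius b l) (cell n (k b.+1) a)]%SET| <= K)%N.
Proof.
move=> bQ gs na; have /andP[_ kn] := kmon bQ.
have [a' a'S Ha'] := near_angle R kn na.
move: a'S; rewrite finset.in_set => /andP[/forallP /(_ (Ordinal bQ)) /= ncr _].
rewrite /crowded -ltnNge in ncr; apply: leq_trans (ltnW ncr).
apply: subset_leq_card; apply/fintype.subsetP => l; rewrite !finset.in_set.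
move=> /existsP[j /andP[fj cj]]; apply/existsP; exists j; rewrite fj /=.
have w0 := gridw_gt0 R (k b.+1).
have h1 := Ha' (gridpt R (k b.+1) (cell n (k b.+1) a)).
have h2 := Ha' (gridpt R (k b.+1) (cell n (k b.+1) a).+1).
rewrite !gridptS in h1 h2 cj.
rewrite (le_trans (@cone_dot_le _ _ _ _ _ _ (2 * gridw R (k b.+1)) cj _ _))//.
- by apply: h1; rewrite lexx lerDl ltW.
- by apply: h2; rewrite lexx lerDl ltW.
have : dist1 (z i) (z j) * (2 * gridw R (k b.+1)) <= 8 * (2 * gridw R (k b.+1)).
  by rewrite ler_wpM2r// mulr_ge0// ltW.
lra.
Qed.

(** [ball_piece_bound] in each ball of the covering at scale [mm b l], with the sector bound
    supplied by [sector_density]; the radii of the covering add up to at most [L]. *)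
Lemma typical_directions_bound b l (a : 'I_(2 ^ n)) (t : R)
    (J : finType) (zc : J -> R * R) (rc : J -> R) :
  (b < Q)%N -> gridpt R n a <= t <= gridpt R n a.+1 -> 0 <= t <= 8 ->
  gridw R (k b) <= 1 / 4 -> 0 < rm (mm b l) -> 0 < rp (mm b l).+1 ->
  16 * rm (mm b l) <= gridw R (k b) ->
  rho <= rm (mm b l) -> 16 * (40 * rho) <= gridw R (k b) * rp (mm b l).+1 ->
  rho <= 2 * rp (mm b l).+1 * gridw R (k b.+1) ->
  (rect_const E (rp (mm b l).+1) (rm (mm b l)) (rm (mm b l))^-1 <= kap%:E)%E ->
  (forall j, rm (mm b l) <= rc j <= rp (mm b l)) ->
  (forall x, E x -> exists j, eball (zc j) (rc j) x) -> \sum_j rc j <= L ->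
  (lebesgue_measure (dot t @` [set x | E x /\ exists2 i,
      (a \in typical i) && (a \notin exceptional b l i) & eball (z i) (rad i) x])
    <= ((2 * kap + (480 * 64) * A * eta) * L)%:E)%E.
Proof.
move=> bQ ht /andP[t0 t8] w4 r0 e0 rw rhor rhow rhok RE rcP Ecov rcL.
have /andP[kk kn] := kmon bQ; have kbn := leq_trans kk kn.
set m := mm b l in r0 e0 rw rhor rhow rhok RE rcP *.
set X := [set x | _].
(* Small enough that the slope [6 * s] is below [gridw R (k b) / 2], and large enough that [s^-1] is
   at most the Lipschitz constant [(rm m)^-1]. Being proportional to the cell width, it cancels the
   width contained in [G]. *)
pose s := gridw R (k b) / 16.
have w0 := gridw_gt0 R (k b).
move: A0 eta0 L0 kap0 rho0 => A0' eta0' L0' kap0' rho0'.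
have s01 : 0 < s <= 1 by rewrite /s; apply/andP; split; lra.
pose G := 4 * A * eta * gridw R (k b).
have G0 : 0 <= G by rewrite /G !mulr_ge0// ltW.
have Gs : 480 * G / s = (480 * 64) * A * eta by rewrite /G /s; field; rewrite gt_eqF.
have [q1 q2] := gridpt_cell R a kbn; have /andP[ht1 ht2] := ht.
(* Angles in [0, 8] stay well inside the grid range [-1, 15], so both neighbours of the cell
   exist. *)
have c0 : (0 < cell n (k b) a)%N.
  rewrite lt0n; apply/eqP => c0; move: q2; rewrite c0.
  by rewrite [gridpt R (k b) 1]/gridpt mul1r; lra.
have c1 : ((cell n (k b) a).+1 < 2 ^ k b)%N.
  rewrite -(ltr_nat R) -(ltr_pM2r w0).
  have -> : (2 ^ k b)%:R * gridw R (k b) = 16.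
    by rewrite /gridw natrX; field; rewrite expf_neq0.
  by move: q1; rewrite -natr1 mulrDl mul1r [gridpt R (k b) _]/gridpt; lra.
pose Xj j := X `&` eball (zc j) (rc j).
have bound j : (lebesgue_measure (dot t @` Xj j) <= ((2 * kap + 480 * G / s) * rc j)%:E)%E.
  have /andP[rj1 rj2] := rcP j.
  apply: (@ball_piece_bound _ _ z rad E t s (rp m.+1) rho (rc j) G (rm m) (rm m)^-1 kap (Xj j)
    (fun i => (a \in typical i) && (a \notin exceptional b l i)) (zc j)) => //.
  - by apply/andP; split; lra.
  - lra.
  - rewrite /s; lra.
  - by move=> x [[_ [i Hi xi]] _]; exists i.
  - by move=> x [].
  - by move=> x [[]].
  - by rewrite lef_pV2 ?posrE//; [rewrite /s; lra|case/andP: s01].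
  move=> i r /andP[aS aE] er; have r0' : 0 < r by lra.
  apply: (@le_trans _ _ (\sum_(j0 | in_sector z t (6 * s) (inner_radius b l) (outer_radius b l) r i j0) 2 * rad j0)).
    apply: sum_subpred => [j0|j0].
      by rewrite mulr_ge0//; have /andP[] := radP j0.
    rewrite /in_sector /inner_radius /outer_radius -/m => /and3P[/andP[-> h] -> ->].
    by rewrite andbT; lra.
  apply: (@sector_density _ _ z rad i n (k b) (k b.+1) (typical i) A rho (inner_radius b l) (outer_radius b l) r
    _ _ _ _ _ _ _ a t (6 * s) eta) => //.
  - by move=> j0; have /andP[] := radP j0.
  - exact: ltW.
  - rewrite (le_trans rhok)// ler_pM2r ?gridw_gt0//; lra.
  - move=> a' w; rewrite finset.in_set => /andP[_ /asboolPn nh] rw'.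
    by rewrite leNgt; apply/negP => hw; apply: nh; exists w.
  - rewrite /s; lra.
  - by move: aE; rewrite finset.in_set aS /= -leNgt.
apply: (@le_trans _ _ (\sum_j ((2 * kap + 480 * G / s) * rc j)%:E)%E).
  apply: (@le_trans _ _ (\sum_j lebesgue_measure (dot t @` Xj j))%E).
    apply: lebesgue_measure_cover => _ [x Xx <-].
    by have [j xj] := Ecov x Xx.1; exists j => //; exists x.
  by apply: lee_sum => j _.
have coef0 : 0 <= 2 * kap + 480 * (G / s).
  have Gs0 : 0 <= G / s by rewrite divr_ge0//; case/andP: s01 => /ltW.
  by lra.
rewrite mulrA Gs in coef0.
by rewrite sumEFin lee_fin -mulr_sumr Gs; exact: ler_wpM2l.
Qed.

End FixedDirection.

(** * Measurability and slicing of the Favard length *)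

Section FavardLength.
Variable R : realType.
Implicit Type E : set (R * R).

(** An open set is the countable union of the boxes contained in it with rational centre and radius
    [e.+1%:R^-1], and boxes are measurable rectangles. *)
Lemma open_prod_measurable (U : set (R * R)) : open U -> measurable U.
Proof.
move=> oU.
pose box (a b : rat) (e : nat) : set (R * R) :=
  (ball (ratr a : R) e.+1%:R^-1) `*` (ball (ratr b : R) e.+1%:R^-1).
pose V := \bigcup_(a : rat) \bigcup_(b : rat) \bigcup_(e : nat)
  (if `[< box a b e `<=` U >] then box a b e else set0).
suff -> : U = V.
  apply: bigcupT_measurable_rat => a; apply: bigcupT_measurable_rat => b.
  apply: bigcupT_measurable => e; case: ifP => // _.
  by apply: measurableX; exact: measurable_ball.
apply/seteqP; split => [[x y] Uxy|p [a _ [b _ [e _]]]]; last first.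
  by case: asboolP => // sub /sub.
have /nbhs_ballP[e e0 eU] := open_nbhs_nbhs (conj oU Uxy).
have [n nP] : exists n : nat, 2 * n.+1%:R^-1 < e.
  exists (Num.truncn (2 / e)); rewrite ltr_pdivrMr// mulrC -ltr_pdivrMr//.
  exact: truncnS_gt.
have n0 : 0 < n.+1%:R^-1 :> R by rewrite invr_gt0.
have rat_near (u : R) : exists q : rat, `|ratr q - u| < n.+1%:R^-1.
  have [|q] := @rat_in_itvoo R (u - n.+1%:R^-1) (u + n.+1%:R^-1).
    by rewrite ltrD2l (lt_trans _ n0)// oppr_lt0.
  by rewrite in_itv /= => qu; exists q; rewrite ltr_distl.
have [a ax] := rat_near x; have [b bY] := rat_near y.
exists a => //; exists b => //; exists n => //.
case: asboolP => [_|]; first by split; rewrite /= /ball /=.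
case=> -[u v] [/= ua vb]; apply: eU; move: nP n0 ax bY ua vb.
rewrite /ball /=; move: (n.+1%:R^-1) => d nP n0 ax bY ua vb; split; rewrite /ball /=.
  by have := ler_distD (ratr a) x u; rewrite (distrC x (ratr a)); lra.
by have := ler_distD (ratr b) y v; rewrite (distrC y (ratr b)); lra.
Qed.

Definition line_set E := [set p : R * R | 0 <= p.2 < 2 * pi /\
  exists2 x, E x & x.1 * cos p.2 + x.2 * sin p.2 = p.1].

(** The lines with angle in the closed interval [[0, 2 * pi]] form a continuous image of a compact
    set; the half-open range is cut out of it by a measurable strip. *)
Lemma line_set_measurable E : compact E -> measurable (line_set E).
Proof.
move=> cE.
pose f (q : (R * R) * R) : R * R := (dot q.2 q.1, q.2).
pose C := f @` (E `*` `[0, 2 * pi]%classic).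
have cf : continuous f.
  move=> q.
  have c3 : (fun q : R * R * R => q.2) @ q --> q.2 by exact: cvg_snd.
  have c0 : (fun q : R * R * R => q.1) @ q --> q.1 by exact: cvg_fst.
  have c1 : (fun q : R * R * R => q.1.1) @ q --> q.1.1.
    have f1 (u : R * R) : (fun v : R * R => v.1) @ u --> u.1 by exact: cvg_fst.
    exact: (cvg_comp _ (fun v : R * R => v.1) c0 (f1 _)).
  have c2 : (fun q : R * R * R => q.1.2) @ q --> q.1.2.
    have f2 (u : R * R) : (fun v : R * R => v.2) @ u --> u.2 by exact: cvg_snd.
    exact: (cvg_comp _ (fun v : R * R => v.2) c0 (f2 _)).
  have cc : (fun q : R * R * R => cos q.2) @ q --> cos q.2.
    exact: (cvg_comp _ (@cos R) c3 (@continuous_cos R _)).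
  have cs : (fun q : R * R * R => sin q.2) @ q --> sin q.2.
    exact: (cvg_comp _ (@sin R) c3 (@continuous_sin R _)).
  have cd : (fun q : R * R * R => dot q.2 q.1) @ q --> dot q.2 q.1.
    by apply: cvgD; apply: cvgM.
  exact: (cvg_pair cd c3).
have cC : compact C.
  apply: continuous_compact; first exact: continuous_subspaceT.
  by apply: compact_setX => //; exact: segment_compact.
have mC : measurable C.
  rewrite -(setCK C); apply: measurableC; apply: open_prod_measurable.
  by apply: closed_openC; apply: compact_closed => //; exact: norm_hausdorff.
have -> : line_set E = C `&` ([set: R] `*` `]-oo, (2 * pi)[%classic).
  apply/seteqP; split => [[c t] /= [/andP[t0 t1] [x Ex xt]]|[c t] /= [[[x s] [/= Ex]]]].
    split; last by split => //=; rewrite in_itv.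
    by exists (x, t) => /=; [split => //=; rewrite in_itv /= t0 ltW|rewrite /f /dot /= xt].
  rewrite !in_itv /= => /andP[t0 t1] [<- <-] [_ st]; split; first by rewrite t0.
  by exists x.
apply: measurableI => //; apply: measurableX => //.
Qed.

Lemma favard_le_grid E n (H : 'I_(2 ^ n) -> R) : compact E -> (forall a, 0 <= H a) ->
  (forall (a : 'I_(2 ^ n)) t, gridpt R n a <= t <= gridpt R n a.+1 -> 0 <= t <= 8 ->
    (lebesgue_measure (dot t @` E) <= (H a)%:E)%E) ->
  (favard E <= (\sum_a H a * gridw R n)%:E)%E.
Proof.
move=> cE H0 HE.
have mE := line_set_measurable cE.
have w0 := gridw_gt0 R n.
have SH0 : 0 <= \sum_a H a * gridw R n.
  by apply: sumr_ge0 => a _; rewrite mulr_ge0// ltW.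
have p2 := pi_ge2 R; have p4 := pihalf_lt2 R.
suff main : ((@lebesgue_measure R \x @lebesgue_measure R) (line_set E)
    <= (\sum_a H a * gridw R n)%:E)%E.
  rewrite /favard -/(line_set E).
  apply: (@le_trans _ _ (((2 * pi)^-1)%:E * (\sum_a H a * gridw R n)%:E)%E).
    by apply: lee_wpmul2l => //; rewrite lee_fin invr_ge0; lra.
  rewrite -EFinM lee_fin ler_piMl// invf_le1; lra.
(* Uniqueness of the product measure exchanges the order of integration, so that sections are taken
   at fixed angle. *)
rewrite (@product_measure_unique _ _ _ _ _ _ _ (@lebesgue_measure R \x^ @lebesgue_measure R)%E)//; last first.
  by move=> A B mA mB; exact: product_measure2E.
rewrite /product_measure2 /=.
pose J (a : 'I_(2 ^ n)) : set R := `[gridpt R n a, gridpt R n a.+1]%classic.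
pose h (t : R) : \bar R := (\sum_a (H a)%:E * (\1_(J a) t)%:E)%E.
have mJ a : measurable (J a) by exact: measurable_itv.
have mh0 a : measurable_fun setT (EFin \o (\1_(J a) : R -> R)).
  by apply/measurable_EFinP; exact: measurable_indic.
have mh1 a : measurable_fun setT (fun t : R => ((H a)%:E * (\1_(J a) t)%:E)%E).
  apply: emeasurable_funM; first exact: measurable_cst.
  by apply/measurable_EFinP; exact: measurable_indic.
have h0 t : (0 <= h t)%E.
  by apply: sume_ge0 => a _; rewrite mule_ge0 ?lee_fin.
apply: (@le_trans _ _ (\int[lebesgue_measure]_t h t)%E).
  apply: ge0_le_integral => //.
  - exact: (@measurable_fun_ysection _ _ _ _ R (@lebesgue_measure R) _ mE).
  - by apply: emeasurable_sum.
  move=> t _ /=.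
  have [t0|t0] := boolP (0 <= t < 2 * pi); last first.
    rewrite (_ : ysection _ _ = set0) ?measure0//.
    apply/seteqP; split => // c; rewrite /ysection /= inE => -[/= h' _].
    by move: t0; rewrite h'.
  have /andP[t1 t2] := t0.
  have t8 : 0 <= t <= 8 by rewrite t1 /=; lra.
  have u0 : 0 <= (t + 1) / gridw R n by rewrite divr_ge0 ?ltW//; lra.
  pose a := Num.truncn ((t + 1) / gridw R n).
  have /andP[a1 a2] : a%:R <= (t + 1) / gridw R n < a.+1%:R.
    exact: truncn_itv.
  have aN : (a < 2 ^ n)%N.
    rewrite -(ltr_nat R) (le_lt_trans a1)// ltr_pdivrMr//.
    have -> : (2 ^ n)%N%:R * gridw R n = 16.
      by rewrite /gridw natrX; field; rewrite expf_neq0.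
    lra.
  have ta : gridpt R n a <= t <= gridpt R n a.+1.
    move: a1 a2; rewrite ler_pdivlMr// ltr_pdivrMr// /gridpt => a1 a2.
    by apply/andP; split; lra.
  apply: (@le_trans _ _ (lebesgue_measure (dot t @` E))).
    apply: lebesgue_measure_le => c; rewrite /ysection /= inE => -[_ [x Ex /= xc]].
    by exists x.
  apply: (le_trans (HE (Ordinal aN) t ta t8)).
  rewrite /h (bigD1 (Ordinal aN))//= indicE (_ : t \in J _); last first.
    by rewrite inE /J /= in_itv.
  rewrite mule1 leeDl// sume_ge0// => b _; rewrite mule_ge0 ?lee_fin//.
rewrite ge0_integral_sum//; last by move=> a t _; rewrite mule_ge0 ?lee_fin.
rewrite -sumEFin; apply: lee_sum => a _.
rewrite ge0_integralZl//; last by rewrite lee_fin.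
  rewrite integral_indic//; last exact: mJ.
  rewrite EFinM lee_wpmul2l ?lee_fin//.
  apply: (@le_trans _ _ (lebesgue_measure (J a))).
    by apply: lebesgue_measure_le => x [].
  rewrite lebesgue_measure_itv /= lte_fin gridptS; case: ifP => _.
    by rewrite -EFinD lee_fin; lra.
  by rewrite lee_fin ltW.
exact: mh0.
Qed.

End FavardLength.

(** * Finite covers from bounds on spherical content *)

Section Covers.
Variable R : realType.
Implicit Type E : set (R * R).

Lemma eball_open (c : R * R) (r : R) : open (eball c r).
Proof.
pose f (y : R * R) : R := (y.1 - c.1) ^+ 2 + (y.2 - c.2) ^+ 2.
have -> : eball c r = f @^-1` [set u | u < r ^+ 2] by [].
apply: open_comp; last exact: open_lt.
move=> y _.
have c1 : (fun y : R * R => y.1 - c.1) @ y --> y.1 - c.1.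
  by apply: cvgB; [exact: cvg_fst|exact: cvg_cst].
have c2 : (fun y : R * R => y.2 - c.2) @ y --> y.2 - c.2.
  by apply: cvgB; [exact: cvg_snd|exact: cvg_cst].
by apply: cvgD; rewrite /continuous_at !expr2; under eq_fun do rewrite expr2; apply: cvgM.
Qed.

(** The infimum need not be attained, hence [2 * L] in place of [L]. Compactness leaves finitely
    many balls, and those missing [E] are dropped so that every centre is close to [E]. *)
Lemma sph_content_finite_cover E (lo hi L : R) : compact E -> 0 < L -> 0 <= lo ->
  (sph_content lo hi E <= L%:E)%E ->
  exists (J : finType) (z : J -> R * R) (rad : J -> R),
    [/\ forall j, lo <= rad j <= hi,
        forall x, E x -> exists j, eball (z j) (rad j) x,
        forall j, exists2 y, E y & eball (z j) (rad j) y &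
        \sum_j 2 * rad j <= 2 * L].
Proof.
move=> cE L0 lo0 hL.
have /ereal_inf_lt[_ [J [c [r [rJ EJ ->]]]] sL] : (sph_content lo hi E < (2 * L)%:E)%E.
  by rewrite (le_lt_trans hL)// lte_fin; lra.
have r0 j : J j -> 0 <= r j by move=> /rJ/andP[]; lra.
have {}cE := eq_ind _ (fun P : set (set (R * R)) => P E) cE _
  (@compact_cover (HB.pack_for ptopologicalType (R * R)%type
     (Pointed.on (R * R)%type) (Topological.on (R * R)%type))).
have [D DJ ED] := cE nat J (fun j => eball (c j) (r j)) (fun j _ => @eball_open (c j) (r j)) EJ.
pose s := [seq j <- finmap.enum_fset D | `[< exists2 y, E y & eball (c j) (r j) y >]].
have sJ j : j \in s -> J j.
  by rewrite mem_filter => /andP[_ /DJ]; rewrite inE.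
have us : uniq s by rewrite filter_uniq// finmap.fset_uniq.
pose t := in_tuple s.
exists 'I_(size s), (fun i => c (tnth t i)), (fun i => r (tnth t i)); split.
- by move=> i; apply/rJ/sJ/mem_tnth.
- move=> x Ex; have [j /= jD xj] := ED x Ex.
  have js : j \in s by rewrite mem_filter jD andbT; apply/asboolP; exists x.
  have /tnthP[i ij] : j \in t by [].
  by exists i; rewrite -ij.
- move=> i; have := mem_tnth i t; rewrite mem_filter => /andP[/asboolP h _].
  exact: h.
rewrite -lee_fin (le_trans _ (ltW sL))//.
rewrite -(big_tnth _ _ s xpredT (fun j => 2 * r j)) -sumEFin.
have [m sm] : exists m, forall j, j \in s -> (j < m)%N.
  exists (\max_(j <- s) j).+1 => j js.
  by rewrite ltnS (@leq_bigmax_seq _ s xpredT id).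
(* Listing the chosen indices in increasing order bounds their sum by a partial sum of the
   series. *)
have ps : perm_eq s [seq j <- iota 0 m | j \in s].
  apply: uniq_perm => //; first by rewrite filter_uniq ?iota_uniq.
  move=> j; rewrite mem_filter mem_iota leq0n add0n /=.
  by case js: (j \in s) => //=; rewrite sm.
rewrite (perm_big _ ps) /= big_filter.
apply: (@le_trans _ _ (\sum_(0 <= j < m | j \in J) (2 * r j)%:E)%E); last first.
  by apply: nneseries_lim_ge => j _; rewrite inE => /r0 rj; rewrite lee_fin mulr_ge0.
rewrite /index_iota subn0 [leLHS]big_mkcond [leRHS]big_mkcond; apply: lee_sum => j _.
case: ifPn => [/sJ Jj|_]; first by rewrite mem_set.
by case: ifPn => //; rewrite inE => /r0 rj; rewrite lee_fin mulr_ge0.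
Qed.

(** Lowering the upper radius leaves fewer covers and raises the content, so the limit at 0 is a
    supremum. *)
Lemma sph_content_le_measure E (rho L : R) : 0 < rho ->
  (sph_measure E <= L%:E)%E -> (sph_content 0 rho E <= L%:E)%E.
Proof.
move=> rho0 mL; pose f (u : R) := sph_content 0 u E.
have fmono : {in Interval (BRight 0) +oo%O &, {homo f : u v / u <= v >-> (v <= u)%E}}.
  move=> u v _ _ uv; apply: ereal_inf_le_tmp => _ [J [c [r [rJ EJ ->]]]].
  exists J, c, r; split => // j /rJ /andP[-> h] /=; exact: le_trans uv.
have b0 : (BRight (0 : R) < +oo)%O by [].
have fl := cvg_lim (@ereal_hausdorff R) (@nonincreasing_at_right_cvge R f 0 +oo%O b0 fmono).
apply: le_trans mL; rewrite /sph_measure -/f fl.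
by apply: ereal_sup_ubound; exists rho => //=; rewrite in_itv /= rho0.
Qed.

End Covers.

(** * Grid levels matched to radii, and gaps between scales *)

Lemma gridw_level (R : realType) (r : R) : 0 < r <= 1 ->
  exists k, r / 8 < gridw R k <= r / 4.
Proof.
move=> /andP[r0 r1].
have ex : exists k, gridw R k <= r / 4.
  exists (Num.truncn (64 / r)).+1; rewrite /gridw ler_pdivrMr ?exprn_gt0//.
  have h1 := truncnS_gt (64 / r); rewrite ltr_pdivrMr// in h1.
  have h2 : (Num.truncn (64 / r)).+1%:R <= 2 ^+ (Num.truncn (64 / r)).+1 :> R.
    by rewrite -natrX ler_nat ltnW// ltn_expl.
  have : (Num.truncn (64 / r)).+1%:R * r <= 2 ^+ (Num.truncn (64 / r)).+1 * r.
    by rewrite ler_pM2r.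
  by lra.
case: (ex_minnP ex) => -[|k] hk mink.
  by move: hk; rewrite /gridw expr0; lra.
exists k.+1; rewrite hk andbT; have := gridwS R k.
have : ~~ (gridw R k <= r / 4) by apply/negP => /mink; rewrite ltnn.
by rewrite -ltNge; lra.
Qed.

Section Scales.
Variables (R : realType) (N : nat) (rm rp : nat -> R).
Hypothesis rmN : 0 < rm N.
Hypothesis rmp : forall m, (1 <= m <= N)%N -> rm m <= rp m.
Hypothesis half : forall m, (1 <= m < N)%N -> rp m.+1 <= rm m / 2.

Lemma scale_gt0 m : (1 <= m <= N)%N -> 0 < rm m.
Proof.
move=> /andP[m1 mN]; rewrite -(subKn mN).
have : (N - m < N)%N by lia.
elim: (N - m)%N => [|d IH] dN; first by rewrite subn0.
have h := IH (ltnW dN); have e : (N - d)%N = (N - d.+1).+1 by lia.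
have h2 : rm (N - d)%N <= rp (N - d)%N by apply: rmp; lia.
have h1 : rp (N - d.+1).+1 <= rm (N - d.+1)%N / 2 by apply: half; lia.
by rewrite e in h h2; lra.
Qed.

(** Every step of the index gains a factor 2, so a distance in the index becomes a ratio of
    radii. *)
Lemma scale_gap a a' c : (0 < a)%N -> (a + c.+1 <= a')%N -> (a' <= N)%N ->
  2 ^+ c.+1 * rp a' <= rm a.
Proof.
move=> a0; elim: c a' => [|c IH] a'.
  elim: a' => [|a' IHa]; first by lia.
  rewrite addn1 ltnS => aa' a'N.
  have h1 : rp a'.+1 <= rm a' / 2 by apply: half; lia.
  have [e|e] := eqVneq a a'; first by rewrite expr1 e; lra.
  have h2 : 2 ^+ 1 * rp a' <= rm a by apply: IHa; lia.
  have h3 : rm a' <= rp a' by apply: rmp; lia.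
  have h4 : 0 < rm a' by apply: scale_gt0; lia.
  by rewrite expr1 in h2 *; lra.
case: a' => [|a'] ca' a'N; first by lia.
have h1 : rp a'.+1 <= rm a' / 2 by apply: half; lia.
have h2 : 2 ^+ c.+1 * rp a' <= rm a by apply: IH; lia.
have h3 : rm a' <= rp a' by apply: rmp; lia.
have h4 : 0 < 2 ^+ c.+1 :> R by rewrite exprn_gt0.
have h5 : 2 ^+ c.+1 * (2 * rp a'.+1) <= 2 ^+ c.+1 * rp a' by rewrite ler_pM2l//; lra.
by rewrite exprSr -mulrA; lra.
Qed.

End Scales.

(** * The projection of [E] in one direction *)

Section DirectionBound.
Variables (R : realType) (E : set (R * R)) (rm rp : nat -> R).
Variables (I : finType) (z : I -> R * R) (rad : I -> R) (rho : R).
Variables (n Q D K : nat) (A eta : R) (nb k : nat -> nat) (mm : nat -> nat -> nat).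

(** A ball containing a given point of [E] is, for the direction [a], exceptional, heavy, crowded
    for some coarse scale, or typical and not exceptional. The four terms bound these cases. *)
Lemma projection_cover b l (a : 'I_(2 ^ n)) (t c1 c2 c3 : R) :
  (forall i, 0 <= rad i) ->
  (forall x, E x -> exists i, eball (z i) (rad i) x) ->
  (forall b : 'I_Q, (lebesgue_measure [set u : R | exists2 i,
     crowded rm rp z n D K nb mm b i a & (`|u - dot t (z i)| <= rad i)%R] <= c1%:E)%E) ->
  (lebesgue_measure [set u : R | exists2 i,
     heavy z rad rho n A i a & (`|u - dot t (z i)| <= rad i)%R] <= c2%:E)%E ->
  (lebesgue_measure (dot t @` [set x | E x /\ exists2 i,
      (a \in typical rm rp z rad rho n Q D K A nb mm i)
      && (a \notin exceptional rm rp z rad rho n Q D K A eta nb k mm b l i)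
      & eball (z i) (rad i) x]) <= c3%:E)%E ->
  (lebesgue_measure (dot t @` E) <= (Q%:R * c1 + c2 + c3 +
     \sum_(i | a \in exceptional rm rp z rad rho n Q D K A eta nb k mm b l i) 2 * rad i)%:E)%E.
Proof.
move=> rad0 covE.
set U1 := fun b : 'I_Q => [set u : R | exists2 i, crowded rm rp z n D K nb mm b i a
  & (`|u - dot t (z i)| <= rad i)%R].
set U2 := [set u : R | exists2 i, heavy z rad rho n A i a & _].
set X := [set x | _ /\ _] => h1 h2 h3.
pose U4 := [set u : R | exists2 i,
  a \in exceptional rm rp z rad rho n Q D K A eta nb k mm b l i & (`|u - dot t (z i)| <= rad i)%R].
have H1 : (lebesgue_measure (\bigcup_b U1 b) <= (Q%:R * c1)%:E)%E.
  apply: (@le_trans _ _ (\sum_(b : 'I_Q) lebesgue_measure (U1 b))%E).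
    by apply: lebesgue_measure_cover => u [b' _ ub]; exists b'.
  apply: (@le_trans _ _ (\sum_(b : 'I_Q) c1%:E)%E).
    by apply: lee_sum => b' _; exact: h1.
  by rewrite sumEFin sumr_const card_ord mulr_natl.
have H4 : (lebesgue_measure U4 <=
   (\sum_(i | a \in exceptional rm rp z rad rho n Q D K A eta nb k mm b l i) 2 * rad i)%:E)%E.
  rewrite -sumEFin; pose F i := [set u : R | (`|u - dot t (z i)| <= rad i)%R].
  apply: (@le_trans _ _ (\sum_(i | a \in exceptional rm rp z rad rho n Q D K A eta nb k mm b l i)
    lebesgue_measure (F i))%E).
    by apply: lebesgue_measure_cover => u [i ai ui]; exists i.
  by apply: lee_sum => i _; apply: (@lebesgue_measure_interval_le _ (dot t (z i))).
have sub : dot t @` E `<=` (\bigcup_b U1 b `|` U2) `|` (dot t @` X `|` U4).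
  move=> _ [x Ex <-]; have [i xi] := covE x Ex.
  have xi' := ltW (eball_dot t (rad0 i) xi).
  have [ex|nex] := boolP (a \in exceptional rm rp z rad rho n Q D K A eta nb k mm b l i).
    by right; right; exists i.
  have [hv|nhv] := boolP (heavy z rad rho n A i a); first by left; right; exists i.
  have [cr|ncr] := boolP [forall b : 'I_Q, ~~ crowded rm rp z n D K nb mm b i a].
    right; left; exists x => //; split => //; exists i => //.
    by rewrite nex andbT finset.in_set cr.
  have /existsP[b' /negbNE cb] : [exists b : 'I_Q, ~~ ~~ crowded rm rp z n D K nb mm b i a].
    by rewrite -negb_forall.
  by left; left; exists b' => //; exists i.
apply: (le_trans (lebesgue_measure_le sub)).
apply: (le_trans (lebesgue_measureU_le _ _)).
apply: (le_trans (leeD (lebesgue_measureU_le _ _) (lebesgue_measureU_le _ _))).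
apply: (le_trans (leeD (leeD H1 h2) (leeD h3 H4))).
by rewrite -!EFinD lee_fin; lra.
Qed.

End DirectionBound.

(** * Choice of the parameters and the final estimate *)

Lemma mul_ge_sqr (R : realType) (r u v : R) : 0 < r -> r / 8 <= u -> r <= v ->
  100 * 10 * (r ^+ 2 / (100 * 100)) <= u * v.
Proof.
move=> r0 hu hv; have h1 : r / 8 * r <= u * v.
  by apply: ler_pM => //; [rewrite divr_ge0// ltW|exact: ltW].
have -> : 100 * 10 * (r ^+ 2 / (100 * 100)) = r ^+ 2 / 10 by field.
by have : 0 < r * r by [rewrite mulr_gt0]; rewrite expr2; lra.
Qed.

Lemma pow_budget q : (1 < q)%N -> (1 + q ^ 3 * (10 * q ^ 7 + 100) <= q ^ 100)%N.
Proof.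
move=> q1; have q0 : (0 < q)%N by exact: ltnW.
have h1 : (q ^ (3 + 7 + 7) <= q ^ 100)%N by rewrite leq_pexp2l.
apply: leq_trans h1; rewrite !expnD.
have h7 : (128 <= q ^ 7)%N by apply: (@leq_trans (2 ^ 7)%N) => //; rewrite leq_exp2r.
have h3 : (1 <= q ^ 3)%N by rewrite expn_gt0 q0.
move: (q ^ 3)%N (q ^ 7)%N h7 h3 => x y h7 h3; clear - h7 h3.
have h : (x * y * 128 <= x * y * y)%N by rewrite leq_mul2l h7 orbT.
have h' : (x * 128 <= x * y)%N by rewrite leq_mul2l h7 orbT.
rewrite mulnDr mulnCA; move: (x * y * y)%N (x * y)%N h h' => u v h h'.
lia.
Qed.

(** The integer [q] stands for the integer part of [N] to the power 1/100; every error term is made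
    a multiple of [L / q]. *)
Lemma favard_bound (R : realType) (E : set (R * R)) (L : R) (N q : nat)
    (rm rp : nat -> R) : (1 < q)%N -> (q ^ 100 <= N)%N -> 0 < L -> compact E ->
  E `<=` [set x | x.1 ^+ 2 + x.2 ^+ 2 < 1] ->
  (sph_measure E <= L%:E)%E -> 0 < rm N ->
  (forall m, (1 <= m <= N)%N -> rm m <= rp m) -> rp 1 <= 1 ->
  (forall m, (1 <= m <= N)%N -> (sph_content (rm m) (rp m) E <= L%:E)%E) ->
  (forall m, (1 <= m < N)%N -> rp m.+1 <= rm m / 2) ->
  (forall m, (1 <= m < N)%N ->
     (rect_const E (rp m.+1) (rm m) (rm m)^-1 <= (q%:R^-1)%:E)%E) ->
  (favard E <= ((16 * (480 * 64 + 64) + 192) * (L / q%:R))%:E)%E.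
Proof.
move=> q1 qN L0 cE E1 mE rmN0 rmp rp1 cov half rect.
have gap := scale_gap rmN0 rmp half.
have rm0 := scale_gt0 rmN0 rmp half.
have rmle a b : (0 < a)%N -> (a < b)%N -> (b <= N)%N -> 2 * rp b <= rm a.
  by move=> a0 ab bN; have := gap a b 0%N a0; rewrite addn1 expr1; apply.
have N0 : (0 < N)%N by rewrite (leq_trans _ qN)// expn_gt0 (ltnW q1).
have rmN_le m : (1 <= m <= N)%N -> rm N <= rm m.
  move=> /andP[m1]; rewrite leq_eqVlt => /orP[/eqP->//|mN].
  have h1 := rmle m N m1 mN (leqnn N).
  have h2 : rm N <= rp N by apply: rmp; rewrite N0 /=.
  by lra.
have rm_le1 m : (1 <= m <= N)%N -> rm m <= 1.
  move=> /andP[m1 mN]; have h := rmp m; rewrite m1 mN in h; have {}h := h isT.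
  move: m1; rewrite leq_eqVlt => /orP[/eqP m1|m1]; first by rewrite -m1 in h *; lra.
  have h1 := rmle 1%N m isT m1 mN; have h2 : rm 1%N <= rp 1%N by apply: rmp; rewrite N0.
  have h3 : 0 < rm m by apply: rm0; rewrite mN ltnW.
  by lra.
have q0 : (0 < q)%N by exact: ltnW.
(* With [K = Q * q] the [Q] crowded sets together cost a multiple of [L / q]; with [D = K * Q] the
   two fractions [1 / Q] and [K / D] of the pigeonhole agree. *)
have [D [Q [K [D0 Q0 K0 [DE QE KE] budget]]]] : exists D Q K,
    [/\ (0 < D)%N, (0 < Q)%N, (0 < K)%N,
      [/\ D%:R = q%:R ^+ 7 :> R, Q%:R = q%:R ^+ 3 :> R & K%:R = q%:R ^+ 4 :> R] &
      (1 + Q * (10 * D + 100) <= N)%N].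
  exists (q ^ 7)%N, (q ^ 3)%N, (q ^ 4)%N; rewrite !expn_gt0 !q0 !natrX; split => //.
  exact: leq_trans (pow_budget q1) qN.
clear qN.
have [nb [nb1 nbS nbN]] : exists nb : nat -> nat, [/\ forall b, (1 <= nb b)%N,
    forall b, nb b.+1 = (nb b + (10 * D + 100))%N &
    forall b, (b <= Q)%N -> (nb b <= N)%N].
  exists (fun b => 1 + b * (10 * D + 100))%N; split => [b|b|b bQ]; [by []|by rewrite mulSn addnCA addnC addnA|].
  by apply: leq_trans budget; rewrite leq_add2l leq_mul2r bQ orbT.
clear budget.
have [mm [mm1 mmnb mmlt mmnext]] : exists mm : nat -> nat -> nat, [/\ forall b l, (0 < mm b l)%N,
    forall b l, (nb b + 10 <= mm b l)%N,
    forall b l l', (l < l')%N -> (mm b l + 10 <= mm b l')%N &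
    forall b l, (l < D)%N -> (mm b l + 100 <= nb b.+1)%N].
  exists (fun b l => nb b + 10 + 10 * l)%N; clear - nbS nb1; split.
  - by move=> b l; have := nb1 b; lia.
  - by move=> b l; lia.
  - by move=> b l l' ll; lia.
  - by move=> b l lD; rewrite nbS; lia.
have nblt b : (nb b < nb b.+1)%N by rewrite nbS; clear; lia.
(* The tiny balls must be small against a cell width times a radius, and such products are at least
   [rm N ^+ 2 / 8]. *)
pose rho := rm N ^+ 2 / (100 * 100).
have rhoE : rho = rm N ^+ 2 / (100 * 100) by [].
have rho0 : 0 < rho by rewrite divr_gt0// exprn_gt0.
have rmN1 : rm N <= 1 by apply: rm_le1; rewrite N0 leqnn.
have rho_rm : 100 * 100 * rho <= rm N.
  have -> : 100 * 100 * rho = rm N ^+ 2 by rewrite /rho; field.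
  by rewrite expr2 ger_pMl.
have [I [z [rad [radP covE meetE sumL]]]] :=
  sph_content_finite_cover cE L0 (lexx 0) (sph_content_le_measure rho0 mE).
have dz i j : dist1 (z i) (z j) <= 8.
  have [y Ey yi] := meetE i; have [y' Ey' yj] := meetE j.
  have /andP[ri0 ri] := radP i; have /andP[rj0 rj] := radP j.
  have d1 := eball_dist1 ri0 yi; have d2 := eball_dist1 rj0 yj.
  have t1 := dist1_triangle y (z i) (z j); have t2 := dist1_triangle y' y (z j).
  rewrite (dist1C (z i) y) in t1.
  have u1 (u v : R) := @norm_lt_of_sqr R u v 1 ler01; have one : 1 ^+ 2 = 1 :> R by rewrite expr1n.
  have a1 : `|y.1| < 1 by apply: (u1 _ y.2); rewrite one; exact: E1.
  have a2 : `|y.2| < 1 by apply: (u1 _ y.1); rewrite one addrC; exact: E1.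
  have a3 : `|y'.1| < 1 by apply: (u1 _ y'.2); rewrite one; exact: E1.
  have a4 : `|y'.2| < 1 by apply: (u1 _ y'.1); rewrite one addrC; exact: E1.
  have n1 := ler_normB y.1 y'.1; have n2 := ler_normB y.2 y'.2.
  have d4 : dist1 y y' <= 4 by rewrite /dist1; clear - a1 a2 a3 a4 n1 n2; lra.
  by clear - d1 d2 t1 t2 d4 ri rj rho_rm rmN1 rho0; lra.
have /choice[k kP] : forall b, exists k, (b <= Q)%N -> rm (nb b) / 8 < gridw R k <= rm (nb b) / 4.
  move=> b; have [bQ|bQ] := leqP b Q; last by exists 0%N.
  have [|k hk] := @gridw_level R (rm (nb b)); last by exists k.
  by rewrite rm0 ?rm_le1// nb1 nbN.
have [n /andP[_ nP]] : exists n, (rho / 2) / 8 < gridw R n <= (rho / 2) / 4.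
  by apply: gridw_level; apply/andP; split; clear - rho0 rho_rm rmN1; lra.
have leaf : 8 * gridw R n <= rho by clear - nP; lra.
have glt k1 k2 : gridw R k2 < gridw R k1 -> (k1 <= k2)%N.
  move=> h; rewrite leqNgt; apply/negP => /ltnW /(gridw_anti R).
  by rewrite leNgt h.
have kmon b : (b < Q)%N -> (k b <= k b.+1 <= n)%N.
  move=> bQ; have /andP[h1 h2] := kP b (ltnW bQ); have /andP[h3 h4] := kP b.+1 bQ.
  have h5 : 2 * rp (nb b.+1) <= rm (nb b).
    exact: (rmle _ _ (nb1 b) (nblt b) (nbN _ bQ)).
  have h6 : rm (nb b.+1) <= rp (nb b.+1) by apply: rmp; rewrite nb1 nbN.
  have h7 : rm N <= rm (nb b.+1) by apply: rmN_le; rewrite nb1 nbN.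
  by apply/andP; split; apply: glt; clear - h1 h2 h3 h4 h5 h6 h7 nP rho_rm rho0; lra.
have qR : 0 < q%:R :> R by rewrite ltr0n.
(* The density [A = q] makes over-full strips cost [48 / q], and [eta] makes [A * eta] equal to
   [1 / q]. The exceptional pairs then cost [1 / eta * (1 / Q + K / D)], again of order [1 / q]. *)
pose A : R := q%:R; pose eta : R := (q%:R ^+ 2)^-1; pose kap : R := q%:R^-1.
have A0 : 0 < A by [].
have eta0 : 0 < eta by rewrite invr_gt0 exprn_gt0.
have kap0 : 0 <= kap by rewrite invr_ge0 ltW.
have rad2 i : 0 <= 2 * rad i by rewrite mulr_ge0//; have /andP[] := radP i.
have mult (i : I) (a : 'I_(2 ^ n)) b : (b < Q)%N ->
    near (typical rm rp z rad rho n Q D K A nb mm i) (k b.+1) (cell n (k b.+1) a) ->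
    (#|[set l : 'I_D | hit z i (k b.+1) (inner_radius rp mm b l) (outer_radius rp mm b l)
       (cell n (k b.+1) a)]%SET| <= K)%N.
  move=> bQ; apply: (typical_multiplicity dz kmon bQ).
  by have /andP[] := kP b.+1 bQ.
have [b [l [bQ lD sparse]]] :=
  exists_sparse_scale (hitp := fun b l i => hit z i (k b.+1) (inner_radius rp mm b l)
    (outer_radius rp mm b l)) rad2 Q0 D0 kmon mult.
have exc := exceptional_weight (k b) (typical rm rp z rad rho n Q D K A nb mm) eta0 rad2 sparse.
pose H (a : 'I_(2 ^ n)) : R := (Q%:R * (14 / K%:R * L) + 48 / A * L +
    (2 * kap + 480 * 64 * A * eta) * L) +
  \sum_(i | a \in exceptional rm rp z rad rho n Q D K A eta nb k mm b l i) 2 * rad i.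
have getcov m : (1 <= m <= N)%N -> exists (J : finType) (zc : J -> R * R) (rc : J -> R),
    [/\ forall j, rm m <= rc j <= rp m, forall x, E x -> exists j, eball (zc j) (rc j) x &
      \sum_j rc j <= L].
  move=> mN; have [J [zc [rc [h1 h2 _ h3]]]] :=
    sph_content_finite_cover cE L0 (ltW (rm0 m mN)) (cov m mN).
  by exists J, zc, rc; split => //; move: h3; rewrite -mulr_sumr; clear; lra.
have mmN b' l' : (b' < Q)%N -> (l' < D)%N -> (mm b' l' + 100 <= nb b'.+1)%N /\ (nb b'.+1 <= N)%N.
  by move=> bQ' lD'; split; [exact: mmnext|exact: nbN].
have bound (a : 'I_(2 ^ n)) t : gridpt R n a <= t <= gridpt R n a.+1 -> 0 <= t <= 8 ->
    (lebesgue_measure (dot t @` E) <= (H a)%:E)%E.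
  move=> ta t8; apply: projection_cover => //.
  - by move=> i; have /andP[] := radP i.
  - move=> b'; have bQ' := ltn_ord b'.
    have nbb : (1 <= nb b'.+1 <= N)%N by rewrite nb1 nbN.
    have [J [zc [rc [h1 h2 h3]]]] := getcov _ nbb.
    have g0 := rmN_le _ nbb.
    apply: (crowded_directions_bound radP meetE dz K0 leaf ta (rm0 _ nbb) _ _ h1 h2 h3).
      by clear - g0 rho_rm rho0; lra.
    move=> l1 l2 /andP[l12 l2D]; have [m1 m2] := mmN b' l2 bQ' l2D.
    have [m3 _] := mmN b' l1 bQ' (ltn_trans l12 l2D).
    have m4 := mmlt b' l1 l2 l12.
    have g1 := gap (mm b' l1).+1 (mm b' l2) 8%N isT; have {g1}g1 : 2 ^+ 9 * rp (mm b' l2) <= rm (mm b' l1).+1.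
      by apply: g1; clear - m1 m2 m4; lia.
    have g2 := gap (mm b' l1).+1 (nb b'.+1) 8%N isT; have {g2}g2 : 2 ^+ 9 * rp (nb b'.+1) <= rm (mm b' l1).+1.
      by apply: g2; clear - m2 m3; lia.
    have mN : (1 <= (mm b' l1).+1 <= N)%N by clear - m2 m3; lia.
    have g3 := rmN_le _ mN; have g4 := rmp _ mN; have g5 := rm0 _ mN.
    by rewrite /outer_radius /inner_radius; clear - g1 g2 g3 g4 g5 rho_rm rho0; lra.
  - exact: (heavy_directions_bound radP dz sumL A0 rho0 leaf ta).
  have [m1 m2] := mmN b l bQ lD.
  have mN : (1 <= mm b l <= N)%N by rewrite mm1; clear - m1 m2; lia.
  have mN' : (1 <= (mm b l).+1 <= N)%N by clear - m1 m2; lia.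
  have [J [zc [rc [h1 h2 h3]]]] := getcov _ mN.
  have /andP[k1 k2] := kP b (ltnW bQ); have /andP[k3 k4] := kP b.+1 bQ.
  have g1 := gap (nb b) (mm b l) 9%N (nb1 b) (mmnb b l).
  have {g1}g1 : 2 ^+ 10 * rp (mm b l) <= rm (nb b) by apply: g1; case/andP: mN.
  have g2 := rmp _ mN; have g3 := rmp _ mN'; have g4 := rm0 _ mN; have g5 := rm0 _ mN'.
  have g6 := rmN_le _ mN; have g7 := rmN_le _ mN'.
  have nbb : (1 <= nb b <= N)%N by rewrite nb1 nbN// ltnW.
  have nbb' : (1 <= nb b.+1 <= N)%N by rewrite nb1 nbN.
  have g8 := rm_le1 _ nbb; have g9 := rmN_le _ nbb; have g10 := rmN_le _ nbb'.
  have sq (u v : R) : rm N / 8 <= u -> rm N <= v -> 100 * 10 * rho <= u * v.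
    move=> hu hv; rewrite rhoE; exact: (mul_ge_sqr rmN0).
  have s1 : 100 * 10 * rho <= gridw R (k b) * rp (mm b l).+1.
    by apply: sq; clear - k1 g9 g3 g7; lra.
  have s2 : 100 * 10 * rho <= gridw R (k b.+1) * rp (mm b l).+1.
    by apply: sq; clear - k3 g10 g3 g7; lra.
  apply: (@typical_directions_bound R E L rm rp I z rad rho n Q D K A eta kap nb k mm
    radP L0 A0 eta0 kap0 rho0 kmon b l a t J zc rc) => //.
  - by clear - k2 g8; lra.
  - by clear - g3 g5; lra.
  - by clear - k1 g1 g2 g4; lra.
  - by clear - rho_rm g6 rho0; lra.
  - by clear - s1 rho0; lra.
  - by clear - s2 rho0; lra.
  - by apply: rect; rewrite mm1; case/andP: mN'.
have H0 a : 0 <= H a.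
  have hL : 0 <= L by exact: ltW.
  have p1 : 0 <= Q%:R * (14 / K%:R * L) by rewrite !mulr_ge0// invr_ge0.
  have p2 : 0 <= 48 / A * L by rewrite !mulr_ge0// invr_ge0 ltW.
  have p3 : 0 <= A * eta * L by rewrite !mulr_ge0// ltW.
  have p4 : 0 <= kap * L by rewrite mulr_ge0.
  have p5 : 0 <= \sum_(i | a \in exceptional rm rp z rad rho n Q D K A eta nb k mm b l i) 2 * rad i.
    by apply: sumr_ge0.
  by rewrite /H; clear - p1 p2 p3 p4 p5; lra.
apply: (le_trans (favard_le_grid cE H0 bound)); rewrite lee_fin.
rewrite -mulr_suml /H big_split /= sumr_const card_ord mulrDl.
have gn : gridw R n * (2 ^ n)%N%:R = 16.
  by rewrite /gridw natrX; field; rewrite expf_neq0.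
have gn0 := gridw_gt0 R n.
set c := Q%:R * _ + _ + _.
have -> : c *+ 2 ^ n * gridw R n = 16 * c.
  by rewrite -mulr_natr -mulrA [_%:R * gridw R n]mulrC gn mulrC.
(* Here 64 is 14 from crowded, 48 from heavy and 2 from flat parts. The total angular range 16
   multiplies [c]. *)
have cE' : c = (480 * 64 + 64) * (L / q%:R).
  rewrite /c /A /eta /kap QE KE; field.
  by rewrite gt_eqF.
have -> : (16 * (480 * 64 + 64) + 192) * (L / q%:R) = 16 * c + 192 * (L / q%:R).
  by rewrite cE'; ring.
rewrite lerD2l.
apply: (le_trans (ler_wpM2r (ltW gn0) exc)).
have -> : 3 / eta * ((\sum_i 2 * rad i) * (2 ^ n)%N%:R * (1 / Q%:R + K%:R / D%:R)) * gridw R n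
  = (\sum_i 2 * rad i) * (3 / eta * (1 / Q%:R + K%:R / D%:R) * (gridw R n * (2 ^ n)%N%:R)).
  by ring.
(* Both fractions equal the inverse cube of [q], so the product is [3 * 2 * 16 / q]; the total
   weight [2 * L] turns 96 into 192. *)
rewrite gn (_ : 3 / eta * (1 / Q%:R + K%:R / D%:R) * 16 = 96 / q%:R); last first.
  by rewrite /eta QE KE DE; field; rewrite gt_eqF.
have : (\sum_i 2 * rad i) * (96 / q%:R) <= 2 * L * (96 / q%:R).
  by rewrite ler_wpM2r// divr_ge0// ltW.
by lra.
Qed.

(** The trivial bound: every projection has measure at most [2 * L], and a grid with a single cell
    of width 16 gives [32 * L]. *)
Lemma favard_le_content (R : realType) (E : set (R * R)) (L : R) : 0 < L -> compact E ->
  (sph_measure E <= L%:E)%E -> (favard E <= (32 * L)%:E)%E.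
Proof.
move=> L0 cE mE.
have [I [z [rad [radP covE _ sumL]]]] :=
  sph_content_finite_cover cE L0 (lexx 0) (sph_content_le_measure ltr01 mE).
apply: (le_trans (@favard_le_grid R E 0 (fun=> 2 * L) cE _ _)).
- by move=> _; rewrite mulr_ge0// ltW.
- move=> a t _ _; apply: (@le_trans _ _ (\sum_i 2 * rad i)%:E); last by rewrite lee_fin.
  rewrite -sumEFin; pose F i := [set u : R | (`|u - dot t (z i)| <= rad i)%R].
  apply: (@le_trans _ _ (\sum_i lebesgue_measure (F i))%E).
    apply: lebesgue_measure_cover => _ [x Ex <-]; have [i xi] := covE x Ex.
    by exists i => //; apply/ltW/(eball_dot t) => //; case/andP: (radP i).
  apply: lee_sum => i _; apply: (@lebesgue_measure_interval_le _ (dot t (z i))) => //.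
  by case/andP: (radP i).
rewrite lee_fin sumr_const card_ord expn0 mulr1n /gridw expr0 divr1; lra.
Qed.

Unset Implicit Arguments.

Theorem theorem1p11 (R : realType) :
  exists C : R, 0 < C /\
  forall (L : R) (E : set (R * R)) (N : nat) (rm rp : nat -> R),
    0 < L ->
    compact E ->
    E `<=` [set x | x.1 ^+ 2 + x.2 ^+ 2 < 1] ->
    (sph_measure E <= L%:E)%E ->
    (1 <= N)%N ->
    0 < rm N ->
    (forall n, (1 <= n <= N)%N -> rm n <= rp n) ->
    (forall n, (1 <= n < N)%N -> rp n.+1 <= rm n) ->
    rp 1 <= 1 ->
    (forall n, (1 <= n <= N)%N -> (sph_content (rm n) (rp n) E <= L%:E)%E) ->
    (forall n, (1 <= n < N)%N -> rp n.+1 <= rm n / 2) ->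
    (forall n, (1 <= n < N)%N ->
       (rect_const E (rp n.+1) (rm n) (rm n)^-1 <= (N%:R `^ (- (1 / 100)))%:E)%E) ->
    (favard E <= (C * N%:R `^ (- (1 / 100)) * L)%:E)%E.
Proof.
pose C0 : R := 16 * (480 * 64 + 64) + 192.
have C00 : 0 < C0 by rewrite /C0; lra.
(* The factor 2 pays for rounding the power of [N] down to an integer; 64 covers the case where that
   integer is 1. *)
exists (2 * C0 + 64); split; first by lra.
move=> L E N rm rp L0 cE E1 mE N1 rmN rmp _ rp1 cov half rect.
pose t : R := N%:R `^ (1 / 100).
have Nt : N%:R `^ (- (1 / 100)) = t^-1 by rewrite powRN.
have t0 : 0 < t by apply: powR_gt0; rewrite ltr0n.
have tN : t ^+ 100 = N%:R.
  rewrite -powR_mulrn ?powR_ge0// -powRrM (_ : 1 / 100 * 100%:R = 1) ?powRr1//.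
  by rewrite div1r mulVf ?pnatr_eq0.
have t1 : 1 <= t.
  rewrite leNgt; apply/negP => t1; have : t ^+ 100 < 1 by rewrite exprn_ilt1 ?ltW.
  by rewrite tN ltrn1 ltnNge N1.
rewrite Nt in rect *.
pose q := Num.truncn t.
have /andP[qt tq] : q%:R <= t < q.+1%:R by apply: truncn_itv; exact: ltW.
have q1 : (0 < q)%N by rewrite truncn_gt0.
have qR : 1 <= q%:R :> R by rewrite ler1n.
(* Since [1 <= q], the bound [t < q + 1] gives [t <= 2 * q]. *)
have tV : q%:R^-1 <= 2 * t^-1.
  rewrite ler_pdivlMr// mulrC ler_pdivrMr; last by lra.
  by move: tq; rewrite -natr1; lra.
have tL : 0 < t^-1 * L by rewrite mulr_gt0// invr_gt0.
(* For [q = 1] the power [t] is below 2, and the trivial bound [32 * L] is at most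
   [64 * (t^-1 * L)]. *)
have [q2|q2] := leqP q 1.
  apply: (le_trans (favard_le_content L0 cE mE)); rewrite lee_fin.
  have q_1 : q = 1%N by apply/eqP; rewrite eqn_leq q2 q1.
  have t2 : 1 / 2 <= t^-1.
    by rewrite q_1 in tV; move: tV; rewrite invr1; lra.
  have : 1 / 2 * L <= t^-1 * L by rewrite ler_pM2r.
  have : 0 < C0 * (t^-1 * L) by rewrite mulr_gt0.
  by lra.
have qN : (q ^ 100 <= N)%N.
  by rewrite -(ler_nat R) natrX -tN lerXn2r ?nnegrE//; lra.
have rect' m : (1 <= m < N)%N -> (rect_const E (rp m.+1) (rm m) (rm m)^-1 <= (q%:R^-1)%:E)%E.
  by move=> /rect h; rewrite (le_trans h)// lee_fin lef_pV2 ?posrE//; lra.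
apply: (le_trans (favard_bound q2 qN L0 cE E1 mE rmN rmp rp1 cov half rect')).
rewrite -/C0 lee_fin.
have h : C0 * (L / q%:R) <= C0 * (2 * (t^-1 * L)).
  by rewrite ler_pM2l// mulrC mulrA ler_pM2r.
by lra.
Qed.
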